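(* Let $H\in(0,1)$, $K\in(0,1]$ with $HK\in(\tfrac12,1)$, let $T>0$, $x_0\in\mathbb{R}$, $L>0$, $L_1>0$, let $k\ge 0$ be an integer, and let $G:\mathbb{R}\to\mathbb{R}$ be a bounded function with compact support $[A,B]$, $A<0<B$, satisfying $\int_A^B G(u)\,du=1$ and $\int_{-\infty}^{\infty}u^jG(u)\,du=0$ for $j=1,2,\dots,k$. Let $\varphi_\epsilon=\epsilon^{\frac{1}{k-HK+2}}$. Let $X=\{X_t\}_{0\le t\le T}$, $x_t$, $\widehat\theta_t X_t$ and $\Theta_{k+1}(L)$ be as defined in the context. Then, for any $0<a\le b<T$, $$\limsup_{\epsilon\to 0}\ \sup_{\theta(\cdot)\in\Theta_{k+1}(L)}\ \sup_{a\le t\le b} E_\theta\big(|\widehat\theta_t X_t-\theta(t)x_t|^2\big)\,\epsilon^{-\min\left(2,\frac{2(k+1)}{k+2-HK}\right)}<\infty .$$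
   Context: Bifractional Brownian motion: $W^{H,K}=\{W^{H,K}_t,t\ge 0\}$ is a centered Gaussian process with covariance $R_{H,K}(s,t)=2^{-K}\big[(t^{2H}+s^{2H})^K-|s-t|^{2HK}\big]$, $s,t\ge 0$. Model: for $\epsilon>0$ and a function $\theta$ (the linear multiplier), $X$ solves $dX_t=\theta(t)X_t\,dt+\epsilon\,dW^{H,K}_t$, $X_0=x_0$, $0\le t\le T$, i.e. $X_t=x_0+\int_0^t\theta(s)X_s\,ds+\epsilon W^{H,K}_t$. The limiting ($\epsilon=0$) solution is $x_t=x_0\exp\big(\int_0^t\theta(s)\,ds\big)$. $E_\theta$ denotes expectation when $\theta(\cdot)$ is the linear multiplier. Estimator: the quantity $\widehat\theta_t X_t$ is defined by the relation $$\widehat\theta_t X_t=\frac1{\varphi_\epsilon}\int_0^T G\Big(\frac{\tau-t}{\varphi_\epsilon}\Big)dX_\tau,$$ where $\int_0^T g(\tau)\,dX_\tau=\int_0^T g(\tau)\theta(\tau)X_\tau\,d\tau+\epsilon\int_0^T g(\tau)\,dW^{H,K}_\tau$, the last integral being the Wiener integral of a deterministic function with respect to the Gaussian process $W^{H,K}$ (the isometric extension to the Gaussian space of $W^{H,K}$ of the map $I_{[0,t]}\mapsto W^{H,K}_t$, with $\langle I_{[0,t]},I_{[0,s]}\rangle=R_{H,K}(t,s)$). Class of functions: for an integer $m\ge 1$, $\Theta_m(L)$ is the class of all functions $\theta:\mathbb{R}\to\mathbb{R}$ which are uniformly bounded by the constant $L$ and $m$-times differentiable, with $|\theta^{(m)}(x)-\theta^{(m)}(y)|\le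 L_1|x-y|$ for all $x,y\in\mathbb{R}$, where $L_1>0$ is a fixed constant and $\theta^{(m)}$ denotes the $m$-th derivative. The claim uses $m=k+1$. *)

(* Defs.v *)
From HB Require Import structures.
From mathcomp Require Import all_boot all_order all_algebra.
From mathcomp Require Import all_classical all_reals all_analysis.

Set Implicit Arguments.
Unset Strict Implicit.
Unset Printing Implicit Defensive.

Import Order.TTheory GRing.Theory Num.Theory.
Import numFieldNormedType.Exports.

Local Open Scope classical_set_scope.
Local Open Scope ring_scope.

Section BifractionalBrownianMotion.
Context {R : realType} {d : measure_display} {Omega : measurableType d}.
Variable P : probability Omega R.

Definition bifbm_cov (H K s t : R) : R :=
  2 `^ (- K) * ((t `^ (2 * H) + s `^ (2 * H)) `^ K - `|s - t| `^ (2 * H * K)).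

(* [normal_prob m 0] is not a Dirac mass in the library (it is a junk uniform
   law), so degenerate Gaussian variables are treated separately. *)
Definition gaussian_rv (X : Omega -> R) : Prop :=
  exists m : R,
    (exists2 s : R, 0 < s & forall V : set R, measurable V ->
        P (X @^-1` V) = normal_prob m s V)
    \/ {ae P, forall w, X w = m}.

Definition gaussian_process (W : R -> {RV P >-> R}) : Prop :=
  forall (n : nat) (c t : 'I_n -> R), (forall i, 0 <= t i) ->
    gaussian_rv (fun w => \sum_(i < n) c i * W (t i) w).

Definition bifractional_brownian_motion (H K : R) (W : R -> {RV P >-> R})
    : Prop :=
  [/\ gaussian_process W,
      (forall t, 0 <= t -> 'E_P[W t]%E = 0%E)
    & (forall s t, 0 <= s -> 0 <= t ->
        covariance P (W s) (W t) = (bifbm_cov H K s t)%:E)].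

End BifractionalBrownianMotion.

Section WienerIntegral.
Context {R : realType} {d : measure_display} {Omega : measurableType d}.
Variables (P : probability Omega R) (H K T : R) (W : R -> {RV P >-> R}).

(* [s] stands for the step function sum of c * 1_[0, t] over (c, t) in s. *)
Definition step := seq (R * R).

Definition step_on (s : step) : Prop :=
  forall p, p \in s -> 0 <= p.2 <= T.

Definition step_fun (s : step) (u : R) : R :=
  \sum_(p <- s) p.1 * \1_(`[0, p.2]) u.

Definition step_sub (s s' : step) : step :=
  s ++ [seq (- p.1, p.2) | p <- s'].

Definition step_dot (s s' : step) : R :=
  \sum_(p <- s) \sum_(q <- s') p.1 * q.1 * bifbm_cov H K p.2 q.2.

Definition step_integral (s : step) (w : Omega) : R :=
  \sum_(p <- s) p.1 * W p.2 w.

Definition step_cauchy (s_ : nat -> step) : Prop :=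
  forall e : R, 0 < e -> exists N : nat, forall m n : nat,
    (N <= m)%N -> (N <= n)%N ->
    step_dot (step_sub (s_ m) (s_ n)) (step_sub (s_ m) (s_ n)) < e.

(* The element of the completion of the step functions (for [step_dot]) given
   by a Cauchy sequence is identified with the function [g] when the sequence
   also tends to [g] in L^2([0, T]). For H * K > 1/2, L^2([0, T]) embeds
   continuously into the completion, hence [g] determines that element. *)
Definition step_represents (s_ : nat -> step) (g : R -> R) : Prop :=
  [/\ forall n, step_on (s_ n),
      step_cauchy s_
    & (\int[lebesgue_measure]_(u in `[0%R, T])
         ((step_fun (s_ n) u - g u) ^+ 2)%:E)%E @[n --> \oo] --> 0%E].

Definition wiener_integral (g : R -> R) (J : {RV P >-> R}) : Prop :=
  exists2 s_ : nat -> step, step_represents s_ g &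
    ('E_P[(fun w => (step_integral (s_ n) w - J w) ^+ 2)%R])%E @[n --> \oo] --> 0%E.

End WienerIntegral.

Section Model.
Context {R : realType} {d : measure_display} {Omega : measurableType d}.
Variables (P : probability Omega R) (H K T : R) (W : R -> {RV P >-> R}).

(* Joint measurability of [X] is what makes the time integrals of [X] random
   variables; it holds for the continuous version of the process. *)
Definition is_solution (x0 eps : R) (theta : R -> R) (X : R -> Omega -> R)
    : Prop :=
  measurable_fun (`[0, T] `*` [set: Omega]) (fun p : R * Omega => X p.1 p.2)
  /\ {ae P, forall w,
       lebesgue_measure.-integrable `[0, T] (fun s => (theta s * X s w)%:E)
       /\ forall t, 0 <= t <= T ->
            X t w = x0 + \int[lebesgue_measure]_(s in `[0, t]) (theta s * X s w)
                    + eps * W t w}.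

Definition limit_solution (x0 : R) (theta : R -> R) (t : R) : R :=
  x0 * expR (\int[lebesgue_measure]_(s in `[0, t]) theta s).

(* [Z] is a version of the integral of the deterministic [g] against dX. *)
Definition dX_integral (eps : R) (theta : R -> R) (X : R -> Omega -> R)
    (g : R -> R) (Z : Omega -> R) : Prop :=
  exists2 J : {RV P >-> R}, wiener_integral H K T W g J &
    {ae P, forall w,
      Z w = \int[lebesgue_measure]_(tau in `[0, T]) (g tau * theta tau * X tau w)
            + eps * J w}.

(* [Y t] is the random variable written (hat theta_t) X_t. *)
Definition is_estimator (G : R -> R) (phi eps : R) (theta : R -> R)
    (X : R -> Omega -> R) (Y : R -> {RV P >-> R}) : Prop :=
  forall t, 0 <= t <= T ->
    exists2 Z : Omega -> R,
      dX_integral eps theta X (fun tau => G ((tau - t) / phi)) Z &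
      {ae P, forall w, Y t w = phi^-1 * Z w}.

End Model.

Definition bandwidth {R : realType} (H K : R) (k : nat) (eps : R) : R :=
  eps `^ (1 / (k%:R - H * K + 2)).

Definition Theta {R : realType} (m : nat) (L L1 : R) : set (R -> R) :=
  [set theta : R -> R |
    [/\ forall x, `|theta x| <= L,
        forall (i : nat) (x : R), (i < m)%N -> derivable (derive1n i theta) x 1
      & forall x y : R, `|derive1n m theta x - derive1n m theta y| <= L1 * `|x - y|]].

(* Main.v *)
Require Import Defs.
From HB Require Import structures.
From mathcomp Require Import all_boot all_order all_algebra.
From mathcomp Require Import all_classical all_reals all_analysis.
From mathcomp Require Import measurable_realfun.
From mathcomp Require Import ring lra zify.

(** The estimator is a kernel smoother with window [t + phi * A, t + phi * B], and
    its error is the sum of three terms.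

    The first is the kernel average of [theta * (X - x)], where [x] is the limit
    solution. The difference [X - x] solves a linear integral equation driven by
    [eps * W]. The kernel sees it only through an integral, so a Gronwall argument
    for integrals and the energy of the noise, whose expectation is computed by
    Tonelli's theorem, give a second moment of order [eps ^+ 2]
    ([gronwall_integral], [expected_noise_energy], [state_error_moment]).

    The second is the bias of smoothing [theta * x]. The kernel reproduces
    polynomials of degree at most [k], so the bias is the average of a Taylor
    remainder of order [phi ^+ k.+1] ([kernel_bias]). The constant must be uniform
    over the class: [theta] is bounded and its last derivative is Lipschitz, so its
    Taylor polynomials are bounded near the origin and hence have bounded
    coefficients ([taylor_family_Theta]); the equation [x' = theta * x] transfers
    the expansion to [x], one degree at a time ([taylor_family_limit_solution]).

    The third is [eps / phi] times the Wiener integral of the kernel. Its second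
    moment is a limit of quadratic forms of step functions. On a grid, the
    increments of the covariance split into a part that is nonnegative, by
    convexity of [|x| `^ (2 * H * K)], and a part that is nonpositive, by concavity
    of [x `^ K]. Absolute values therefore still telescope along rows, and Schur's
    test bounds the form by the row sums times the squared L2 norm. Rows over a
    window of length [l] away from the origin have sums of order
    [l `^ (2 * H * K - 1)] per unit of length, which gives a second moment of order
    [phi `^ (2 * H * K)] ([major_window_le], [step_dot_le],
    [wiener_integral_moment_le]).

    The mean square error is thus at most a constant times
    [eps ^+ 2 + phi ^+ (2 * k.+1) + eps ^+ 2 * phi `^ (2 * H * K - 2)]
    ([estimator_mse_bound]). The bandwidth makes the last two terms equal to
    [eps `^ (2 * k.+1 / (k.+2 - H * K))], an exponent smaller than [2]
    ([bandwidth_rate]). *)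

Set Implicit Arguments.
Unset Strict Implicit.
Unset Printing Implicit Defensive.

Import Order.TTheory GRing.Theory Num.Theory.
Import numFieldNormedType.Exports.

Local Open Scope classical_set_scope.
Local Open Scope ring_scope.

(** * Inequalities between real powers *)

Section PowerInequalities.
Context {R : realType}.
Implicit Types a b c d u v w p q x y t : R.

Lemma powR_MVT q u v : 0 < u -> u < v ->
  exists2 c, u < c < v & v `^ q - u `^ q = q * c `^ (q - 1) * (v - u).
Proof.
move=> u0 uv.
have pos (x : R) : x \in `]u, v[ -> x \in `]0, +oo[.
  by rewrite !in_itv/= andbT => /andP[ux _]; exact: lt_trans ux.
have der (x : R) : 0 < x -> is_derive x 1 (@powR R ^~ q) (q * x `^ (q - 1)).
  move=> x0; have xI : x \in `]0, +oo[ by rewrite in_itv/= andbT.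
  have dx := @derivable_powR R 1 q _ xI.
  by apply: DeriveDef => //; rewrite -derive1E powR_derive1.
have [||c] := @MVT R (@powR R ^~ q) (fun x => q * x `^ (q - 1)) u v uv.
- move=> x; rewrite in_itv/= => /andP[ux _]; apply: der.
  exact: lt_trans ux.
- apply: continuous_in_subspaceT => x; rewrite inE/= in_itv/= => /andP[ux _].
  apply: differentiable_continuous; apply/derivable1_diffP.
  apply: derivable_powR; rewrite in_itv/= andbT; exact: lt_le_trans ux.
by rewrite in_itv/= => uc ->; exists c.
Qed.

Lemma powR_lip p u v w : 1 <= p -> 0 <= u -> u <= v -> v <= w ->
  v `^ p - u `^ p <= p * w `^ (p - 1) * (v - u).
Proof.
move=> p1 u0 uv vw.
have v0 : 0 <= v by exact: le_trans uv.
have mono c : 0 <= c -> c <= w -> c `^ (p - 1) <= w `^ (p - 1).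
  by move=> c0 cw; rewrite ge0_ler_powR ?nnegrE ?subr_ge0//; exact: le_trans cw.
move: u0; rewrite le_eqVlt => /predU1P[<-|u0].
  rewrite powR0 ?gt_eqF ?(lt_le_trans _ p1)// !subr0.
  rewrite -(@mulr_powRB1 _ v)// ?(lt_le_trans _ p1)// mulrC.
  rewrite ler_wpM2r// (le_trans (mono _ v0 vw))// ler_peMl// powR_ge0//.
move: uv; rewrite le_eqVlt => /predU1P[->|uv]; first by rewrite !subrr mulr0.
have [c /andP[uc cv] ->] := @powR_MVT p u v u0 uv.
rewrite ler_wpM2r ?subr_ge0 ?(ltW uv)//.
rewrite ler_wpM2l ?(le_trans _ p1)// mono//.
  by rewrite ltW// (lt_trans u0).
by rewrite ltW// (lt_le_trans cv).
Qed.

(** The mean value theorem at two points ordered by concavity; when [c = 0] the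
    derivative blows up and the claim is subadditivity, got by homogeneity. *)
Lemma powR_concave4 q a b c d : 0 <= q <= 1 -> 0 <= c -> c <= a -> c <= b ->
  a + b = c + d -> c `^ q + d `^ q <= a `^ q + b `^ q.
Proof.
move=> /andP[q0 q1] c0; wlog ab : a b / a <= b.
  move=> H ca cb abcd; have [|/ltW] := leP a b; first by move/H; apply.
  by move/H; rewrite [X in _ -> _ <= X]addrC; apply => //; rewrite addrC.
move=> ca cb abcd.
have bd : b <= d by lra.
have [ac0|ac0] := eqVneq a c.
  by rewrite ac0 (_ : d = b)//; lra.
have {}ca : c < a by rewrite lt_neqAle eq_sym ac0.
have {}bd : b < d by lra.
have a0 : 0 < a by exact: le_lt_trans ca.
have b0 : 0 < b by exact: lt_le_trans ab.
have d0 : 0 < d by exact: lt_trans bd.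
move: c0; rewrite le_eqVlt => /predU1P[c0|c0]; last first.
  have [x /andP[cx xa] Hx] := @powR_MVT q c a c0 ca.
  have [y /andP[ay yb] Hy] := @powR_MVT q b d b0 bd.
  suff : d `^ q - b `^ q <= a `^ q - c `^ q by lra.
  rewrite Hx Hy (_ : d - b = a - c); last by lra.
  rewrite ler_wpM2r ?subr_ge0 ?(ltW ca)// ler_wpM2l//.
  have xy : x <= y by lra.
  have x0 : 0 < x by exact: lt_trans cx.
  rewrite (_ : q - 1 = - (1 - q)); last by ring.
  rewrite !powRN lef_pV2 ?posrE ?powR_gt0//; last exact: lt_le_trans xy.
  rewrite ge0_ler_powR ?nnegrE ?subr_ge0// ltW//; exact: lt_le_trans xy.
subst c.
have [->|qn0] := eqVneq q 0; first by rewrite !powRr0.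
rewrite powR0// add0r.
have aux x : 0 < x -> x <= d -> x / d * d `^ q <= x `^ q.
  move=> x0 xd.
  have xdE : x = (x / d) * d by rewrite divfK// gt_eqF.
  have xd0 : 0 < x / d by rewrite divr_gt0.
  rewrite {2}xdE powRM ?(ltW xd0) ?(ltW d0)// ler_wpM2r ?powR_ge0//.
  by rewrite ger1_powR// divr_gt0//= ler_pdivrMr// mul1r.
have := aux a a0; have := aux b b0.
have : a / d * d `^ q + b / d * d `^ q = d `^ q.
  by rewrite -!mulrDl abcd add0r divff ?gt_eqF// mul1r.
have ad : a <= d by lra.
have bd' := ltW bd.
by move=> H /(_ bd') Hb /(_ ad) Ha; lra.
Qed.

Lemma powR_norm_convex p x y t : 1 <= p -> 0 <= t <= 1 ->
  `|t * x + (1 - t) * y| `^ p <= t * `|x| `^ p + (1 - t) * `|y| `^ p.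
Proof.
move=> p1 /andP[t0 t1].
have p0 : 0 <= p by exact: le_trans p1.
apply: (@le_trans _ _ ((t * `|x| + (1 - t) * `|y|) `^ p)).
  rewrite ge0_ler_powR ?nnegrE//.
    by rewrite addr_ge0 ?mulr_ge0 ?subr_ge0.
  rewrite (le_trans (ler_normD _ _))// !normrM ger0_norm// [X in _ + X * _]ger0_norm//.
  by rewrite subr_ge0.
have tI : 0 <= t <= 1 by rewrite t0.
have := @convex_powR R p p1 (Itv01 t0 t1) `|x| `|y|.
rewrite !inE/= !in_itv/= !normr_ge0/= => /(_ isT isT).
by rewrite !convRE/=.
Qed.

(** Among pairs with a given sum, a convex function is largest at the most
    distant pair: [a] and [b] have conjugate weights between [c] and [d]. *)
Lemma powR_norm_convex4 p a b c d : 1 <= p -> c <= a -> c <= b ->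
  a + b = c + d -> `|a| `^ p + `|b| `^ p <= `|c| `^ p + `|d| `^ p.
Proof.
move=> p1 ca cb abcd.
have [cd|cd] := eqVneq c d.
  have -> : a = c by lra.
  by have -> : b = d by lra.
have {}cd : c < d by rewrite lt_neqAle cd/=; lra.
have dc0 : 0 < d - c by lra.
have tP x : c <= x -> x <= d -> let t := (d - x) / (d - c) in
    0 <= t <= 1 /\ x = t * c + (1 - t) * d.
  move=> cx xd t; split; last by rewrite /t; field; rewrite gt_eqF.
  by rewrite divr_ge0 ?subr_ge0 ?(ltW cd)//= ler_pdivrMr// mul1r; lra.
have ad : a <= d by lra.
have bd : b <= d by lra.
have [ta ea] := tP a ca ad; have [tb eb] := tP b cb bd.
have := @powR_norm_convex p c d _ p1 ta; rewrite -ea.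
have := @powR_norm_convex p c d _ p1 tb; rewrite -eb.
have : (d - b) / (d - c) = 1 - (d - a) / (d - c).
  by rewrite (_ : b = c + d - a); [field; rewrite gt_eqF|lra].
move=> ->; lra.
Qed.

End PowerInequalities.

(** * Rectangular increments of the covariance *)

(* [lra] on goals with powers: they are generalized first, since comparing two of
   them by conversion unfolds the exponential series *)
Ltac powlra :=
  repeat match goal with H : context [@powR _ _ _] |- _ => revert H end;
  repeat match goal with |- context [@powR ?R ?a ?b] => generalize (@powR R a b) end;
  intros; lra.

Section Kernel.
Context {R : realType}.
Implicit Types (C : R -> R -> R) (x y u v s t : R).

(** The mass that the kernel [C] gives to the rectangle ]x, y] * ]u, v]: for a
    covariance, the covariance of the increments over ]x, y] and ]u, v]. *)
Definition rect C x y u v := C y v - C x v - C y u + C x u.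

Variables (H K : R).
Hypotheses (H1 : 0 < H < 1) (K1 : 0 < K <= 1) (HK1 : 2^-1 < H * K < 1).

Let p := 2 * H * K.

Definition sum_kernel s t := (s `^ (2 * H) + t `^ (2 * H)) `^ K.
Definition dist_kernel s t := `|s - t| `^ (2 * H * K).

(** Both kernels contribute with a fixed sign to the mass of a rectangle, so
    changing the sign of one of them turns absolute masses into masses, whose
    sum over a row of rectangles telescopes. *)
Definition major_kernel s t := 2 `^ (- K) * (- sum_kernel s t - dist_kernel s t).

Let p1 : 1 <= p. Proof. by rewrite /p -mulrA; case/andP: HK1 => ? _; lra. Qed.
Let p2 : p <= 2. Proof. by rewrite /p -mulrA; case/andP: HK1 => _ ?; lra. Qed.
Let H2 : 1 <= 2 * H.
Proof.
case/andP: HK1 => HK _; case/andP: K1 => _ K1'; case/andP: H1 => H0 _.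
have : H * K <= H by rewrite ler_piMr// ltW.
lra.
Qed.
Let q0 : 0 <= 2 * H. Proof. exact: le_trans H2. Qed.
Let K01 : 0 <= K <= 1. Proof. by case/andP: K1 => ? ->; rewrite ltW. Qed.
Let p0 : p != 0. Proof. by rewrite gt_eqF// (lt_le_trans _ p1). Qed.

Lemma dist_rect_le0 x y u v : x <= y -> u <= v -> rect dist_kernel x y u v <= 0.
Proof.
move=> xy uv; rewrite /rect /dist_kernel -/p.
suff : `|y - v| `^ p + `|x - u| `^ p <= `|x - v| `^ p + `|y - u| `^ p by powlra.
by apply: powR_norm_convex4 => //; lra.
Qed.

Lemma sum_rect_le0 x y u v : 0 <= x -> x <= y -> 0 <= u -> u <= v ->
  rect sum_kernel x y u v <= 0.
Proof.
move=> x0 xy u0 uv; rewrite /rect /sum_kernel.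
have mono a b : 0 <= a -> a <= b -> a `^ (2 * H) <= b `^ (2 * H).
  move=> a0 ab; rewrite ge0_ler_powR ?nnegrE//.
  exact: le_trans ab.
have x'0 := powR_ge0 x (2 * H); have u'0 := powR_ge0 u (2 * H).
have xy' := mono _ _ x0 xy; have uv' := mono _ _ u0 uv.
move: x'0 u'0 xy' uv'; move: (x `^ _) (y `^ _) (u `^ _) (v `^ _).
move=> x' y' u' v' x'0 u'0 xy' uv' {mono}.
suff : (x' + u') `^ K + (y' + v') `^ K <= (y' + u') `^ K + (x' + v') `^ K by powlra.
by apply: powR_concave4 => //; lra.
Qed.

Lemma rect_major x y u v : rect major_kernel x y u v =
  2 `^ (- K) * (- rect sum_kernel x y u v - rect dist_kernel x y u v).
Proof.
rewrite /rect /major_kernel; move: sum_kernel dist_kernel (2 `^ _) => f g c.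
ring.
Qed.

Lemma rect_cov_le x y u v : 0 <= x -> x <= y -> 0 <= u -> u <= v ->
  `|rect (bifbm_cov H K) x y u v| <= rect major_kernel x y u v.
Proof.
move=> x0 xy u0 uv; rewrite rect_major.
have -> : rect (bifbm_cov H K) x y u v =
    2 `^ (- K) * (rect sum_kernel x y u v - rect dist_kernel x y u v).
  have covE s t : bifbm_cov H K s t = 2 `^ (- K) * (sum_kernel s t - dist_kernel s t).
    by rewrite /bifbm_cov [X in X `^ K - _]addrC.
  rewrite /rect !covE; move: sum_kernel dist_kernel (2 `^ _) => f g c.
  ring.
rewrite normrM (ger0_norm (powR_ge0 _ _)) ler_wpM2l ?powR_ge0//.
rewrite ler_norml.
move: (dist_rect_le0 xy uv) (sum_rect_le0 x0 xy u0 uv).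
move: (rect _ _ _ _ _) (rect _ _ _ _ _) => r s.
lra.
Qed.

(** For a window [u, v] that contains [x, y] the four distances are increments
    of the power function over intervals of length [y - x] inside [0, v - u]. *)
Lemma dist_rect_bound x y u v : u <= x -> x <= y -> y <= v ->
  - rect dist_kernel x y u v <= 2 * p * (v - u) `^ (p - 1) * (y - x).
Proof.
move=> ux xy yv; rewrite /rect /dist_kernel -/p.
have n1 : `|x - v| = v - x by rewrite distrC ger0_norm// subr_ge0 (le_trans xy).
have n2 : `|y - v| = v - y by rewrite distrC ger0_norm// subr_ge0.
have n3 : `|x - u| = x - u by rewrite ger0_norm// subr_ge0.
have n4 : `|y - u| = y - u by rewrite ger0_norm// subr_ge0 (le_trans ux).
rewrite n1 n2 n3 n4.
have A1 : (y - u) `^ p - (x - u) `^ p <= p * (v - u) `^ (p - 1) * (y - u - (x - u)).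
  by apply: powR_lip => //; lra.
have A2 : (v - x) `^ p - (v - y) `^ p <= p * (v - u) `^ (p - 1) * (v - x - (v - y)).
  by apply: powR_lip => //; lra.
have e1 : y - u - (x - u) = y - x by ring.
have e2 : v - x - (v - y) = y - x by ring.
by rewrite e1 in A1; rewrite e2 in A2; powlra.
Qed.

(** The row of all rectangles up to the time horizon: here the singularity of
    the kernel at the origin is harmless because a row that starts at [0] sees
    only the increment of [t `^ p]. *)
Lemma major_row_le T x y : 0 <= x -> x <= y -> y <= T ->
  rect major_kernel x y 0 T <= 3 * p * T `^ (p - 1) * (y - x).
Proof.
move=> x0 xy yT; rewrite rect_major.
have y0 : 0 <= y by exact: le_trans xy.
have T0 : 0 <= T by exact: le_trans yT.
have hd := dist_rect_bound x0 xy yT; rewrite subr0 in hd.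
have hs : - rect sum_kernel x y 0 T <= p * T `^ (p - 1) * (y - x).
  rewrite /rect /sum_kernel (@powR0 _ (2 * H)) ?gt_eqF ?(lt_le_trans _ H2)//.
  rewrite !addr0 -!powRrM -/p.
  have hl : y `^ p - x `^ p <= p * T `^ (p - 1) * (y - x) by exact: powR_lip.
  suff : (x `^ (2 * H) + T `^ (2 * H)) `^ K <= (y `^ (2 * H) + T `^ (2 * H)) `^ K by powlra.
  case/andP: K01 => K0 _.
  rewrite ge0_ler_powR ?nnegrE ?addr_ge0 ?powR_ge0// lerD2r.
  by rewrite ge0_ler_powR ?nnegrE.
have pos : 0 <= - rect sum_kernel x y 0 T - rect dist_kernel x y 0 T.
  by rewrite subr_ge0 (le_trans (dist_rect_le0 xy T0))// oppr_ge0 sum_rect_le0.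
apply: (@le_trans _ _ (- rect sum_kernel x y 0 T - rect dist_kernel x y 0 T)).
  apply: ler_piMl => //; rewrite powRN invf_le1 ?powR_gt0//.
  by have := @ler_powR R 2 _ 0 K; rewrite powRr0; apply => //; [lra|case/andP: K01].
apply: (le_trans (lerD hs hd)).
by powlra.
Qed.

(** Away from the origin the sum kernel is smooth, and a short window of
    length [v - u] gains the factor [(v - u) `^ (p - 1)] from both kernels. *)
Lemma major_window_le c T : 0 < c -> exists C : R, forall x y u v,
  c <= u -> u <= x -> x <= y -> y <= v -> v <= T ->
  rect major_kernel x y u v <= C * (v - u) `^ (p - 1) * (y - x).
Proof.
move=> c0.
pose c' := c `^ (2 * H); pose l := 2 * H * T `^ (2 * H - 1).
pose M := K * ((1 - K) * c' `^ (K - 2)) * l * l.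
exists (2 * p + M * T `^ (2 - p)).
move=> x y u v cu ux xy yv vT; rewrite rect_major.
have c'0 : 0 < c' by exact: powR_gt0.
have u0 : 0 < u by exact: lt_le_trans cu.
have x0 : 0 < x by exact: lt_le_trans ux.
have y0 : 0 < y by exact: lt_le_trans xy.
have v0 : 0 < v by exact: lt_le_trans yv.
have T0 : 0 < T by exact: lt_le_trans vT.
have uv : u <= v by lra.
case/andP: (K01) => K0 K1'.
have l0 : 0 <= l by rewrite mulr_ge0 ?powR_ge0// (le_trans ler01).
have M0 : 0 <= M.
  rewrite /M; do 2 (apply: mulr_ge0; last exact: l0).
  by apply: mulr_ge0 => //; apply: mulr_ge0; [rewrite subr_ge0|exact: powR_ge0].
have hd := dist_rect_bound ux xy yv.
have hs : - rect sum_kernel x y u v <= M * (v - u) * (y - x).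
  rewrite /M {M M0} /rect /sum_kernel.
  have mono a b : 0 < a -> a <= b -> a `^ (2 * H) <= b `^ (2 * H).
    by move=> a0 ab; rewrite ge0_ler_powR ?nnegrE// ltW// (lt_le_trans a0).
  have lip a b : 0 < a -> a <= b -> b <= T ->
      b `^ (2 * H) - a `^ (2 * H) <= l * (b - a).
    by move=> a0 ab bT; apply: powR_lip => //; exact: ltW.
  have yT := le_trans yv vT.
  move: (mono _ _ c0 cu) (mono _ _ u0 uv) (mono _ _ x0 xy) (powR_gt0 (2 * H) x0)
        (lip _ _ x0 xy yT) (lip _ _ u0 uv vT); rewrite -/c'.
  move: c' c'0 l l0 {mono lip} => c' c'0 l l0.
  move: (x `^ _) (y `^ _) (u `^ _) (v `^ _) => x' y' u' v' c'u' u'v' x'y' x'0 lip1 lip2.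
  (* one mean value theorem in each variable; all arguments stay above [c'],
     where the second derivative of [z `^ K] is bounded *)
  have key : (y' + u') `^ K - (x' + u') `^ K - ((y' + v') `^ K - (x' + v') `^ K)
      <= K * ((1 - K) * c' `^ (K - 2)) * (v' - u') * (y' - x').
    have [->|x'ny'] := eqVneq x' y'; first by rewrite !subrr mulr0.
    have {x'ny'} x'y'lt : x' < y' by rewrite lt_neqAle x'ny'.
    have [->|u'nv'] := eqVneq u' v'; first by rewrite !subrr mulr0 mul0r.
    have {u'nv'} u'v'lt : u' < v' by rewrite lt_neqAle u'nv'.
    pose phi z := (z + u') `^ K - (z + v') `^ K.
    have der (z : R) : 0 < z -> is_derive z 1 phi
        (K * (z + u') `^ (K - 1) - K * (z + v') `^ (K - 1)).
      move=> z0.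
      have der1 w : 0 < w -> is_derive z 1 (fun z => (z + w) `^ K) (K * (z + w) `^ (K - 1)).
        move=> w0; have zw : z + w \in `]0, +oo[ by rewrite in_itv/= andbT addr_gt0.
        have dw : is_derive (z + w) 1 (@powR R ^~ K) (K * (z + w) `^ (K - 1)).
          have dx := @derivable_powR R 1 K _ zw.
          by apply: DeriveDef => //; rewrite -derive1E powR_derive1.
        have sh : is_derive z 1 (fun z : R => z + w) 1.
          by apply: is_derive_eq; rewrite addr0.
        by have := @is_derive1_comp R (@powR R ^~ K) (fun z : R => z + w) z _ _ dw sh; rewrite mulr1.
      apply: is_deriveB; apply: der1; lra.
    have [||z] := @MVT R phi (fun z => K * (z + u') `^ (K - 1) - K * (z + v') `^ (K - 1))
        x' y' x'y'lt.
    - by move=> z; rewrite in_itv/= => /andP[? _]; apply: der; lra.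
    - apply: continuous_in_subspaceT => z; rewrite inE/= in_itv/= => /andP[? _].
      apply: differentiable_continuous; apply/derivable1_diffP.
      by apply: ex_derive; apply: der; lra.
    rewrite in_itv/= => /andP[xz zy] E.
    have -> : (y' + u') `^ K - (x' + u') `^ K - ((y' + v') `^ K - (x' + v') `^ K)
      = phi y' - phi x' by rewrite /phi; ring.
    rewrite E ler_wpM2r ?subr_ge0// -mulrBr -!mulrA ler_wpM2l//.
    have [||w /andP[w1 w2] E'] := @powR_MVT _ (K - 1) (z + u') (z + v'); [lra|lra|].
    have -> : (z + u') `^ (K - 1) - (z + v') `^ (K - 1) =
      (1 - K) * (w `^ (K - 1 - 1) * (v' - u')) by rewrite -opprB E'; ring.
    rewrite ler_wpM2l ?subr_ge0// ler_wpM2r ?subr_ge0//.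
    have -> : K - 1 - 1 = - (2 - K) by ring.
    have -> : K - 2 = - (2 - K) by ring.
    have c'w : c' <= w by lra.
    rewrite !powRN lef_pV2 ?posrE ?powR_gt0//; last by lra.
    by rewrite ge0_ler_powR ?nnegrE//; lra.
  have -> : - ((y' + v') `^ K - (x' + v') `^ K - (y' + u') `^ K + (x' + u') `^ K) =
     (y' + u') `^ K - (x' + u') `^ K - ((y' + v') `^ K - (x' + v') `^ K) by ring.
  apply: (le_trans key).
  have -> : K * ((1 - K) * c' `^ (K - 2)) * l * l * (v - u) * (y - x) =
     K * ((1 - K) * c' `^ (K - 2)) * (l * (v - u)) * (l * (y - x)) by ring.
  have k0 : 0 <= K * ((1 - K) * c' `^ (K - 2)).
    by rewrite !mulr_ge0 ?powR_ge0// subr_ge0.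
  apply: ler_pM; [| |exact: ler_wpM2l|exact: lip1].
    by apply: mulr_ge0; rewrite ?subr_ge0.
  by rewrite subr_ge0.
clearbody M; clear l l0 c' c'0.
(* the factor [v - u] of the smooth kernel is better than the one that is kept *)
have gain : v - u <= T `^ (2 - p) * (v - u) `^ (p - 1).
  have [->|nuv] := eqVneq v u.
    by rewrite subrr mulr_ge0 ?powR_ge0.
  have vu0 : 0 < v - u by rewrite subr_gt0 lt_neqAle eq_sym nuv.
  have {1}-> : v - u = (v - u) `^ (2 - p) * (v - u) `^ (p - 1).
    rewrite -powRD ?(gt_eqF vu0) ?implybT// (_ : 2 - p + (p - 1) = 1).
      by rewrite powRr1// ltW.
    by ring.
  rewrite ler_wpM2r ?powR_ge0// ge0_ler_powR ?nnegrE ?subr_ge0 ?(ltW T0)//.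
  by rewrite lerBlDr (le_trans vT)// lerDl ltW.
have pos : 0 <= - rect sum_kernel x y u v - rect dist_kernel x y u v.
  rewrite subr_ge0 (le_trans (dist_rect_le0 xy uv))// oppr_ge0.
  exact: sum_rect_le0 (ltW x0) xy (ltW u0) uv.
apply: (@le_trans _ _ (- rect sum_kernel x y u v - rect dist_kernel x y u v)).
  apply: ler_piMl => //; rewrite powRN invf_le1 ?powR_gt0//.
  by have := @ler_powR R 2 _ 0 K; rewrite powRr0; apply => //; rewrite ler1n.
apply: (le_trans (lerD hs hd)).
have : M * (v - u) * (y - x) <= M * (T `^ (2 - p) * (v - u) `^ (p - 1)) * (y - x).
  by rewrite ler_wpM2r ?subr_ge0// ler_wpM2l.
by powlra.
Qed.

Lemma bifbm_cov0l t : 0 <= t -> bifbm_cov H K 0 t = 0.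
Proof.
move=> t0; rewrite /bifbm_cov powR0 ?gt_eqF ?(lt_le_trans _ H2)//.
by rewrite addr0 sub0r normrN ger0_norm// -powRrM subrr mulr0.
Qed.

Lemma bifbm_covC s t : bifbm_cov H K s t = bifbm_cov H K t s.
Proof. by rewrite /bifbm_cov (distrC s t) (addrC (t `^ _) (s `^ _)). Qed.

Lemma bifbm_var t : 0 <= t -> bifbm_cov H K t t = t `^ p.
Proof.
move=> t0; rewrite /bifbm_cov subrr normr0 -/p (powR0 p0) subr0.
have -> : t `^ (2 * H) + t `^ (2 * H) = 2 * t `^ (2 * H) by rewrite (mulr_natl (t `^ _) 2) mulr2n.
rewrite (powRM _ (ler0n _ 2) (powR_ge0 _ _)) mulrA -powRD; last first.
  by rewrite pnatr_eq0 implybT.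
by rewrite addNr powRr0 mul1r -powRrM.
Qed.

End Kernel.

(** * Schur's test and grids *)

Section SchurTest.
Context {R : realType}.

Lemma weighted_AGM (a b c d : R) : 0 <= c -> c * d = 1 ->
  a * b <= 2^-1 * (c * a ^+ 2 + d * b ^+ 2).
Proof.
move=> c0 cd.
have cn0 : c != 0.
  by apply/eqP => c0'; move/eqP: cd; rewrite c0' mul0r eq_sym oner_eq0.
have dE : d = c^-1 by rewrite -[d]mul1r -(mulVf cn0) -mulrA cd mulr1.
have : 0 <= c^-1 * (c * a - b) ^+ 2 by rewrite mulr_ge0 ?sqr_ge0// invr_ge0.
have -> : c^-1 * (c * a - b) ^+ 2 = c * a ^+ 2 + d * b ^+ 2 - 2 * (a * b).
  by rewrite dE; field.
by lra.
Qed.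

(** Schur's test with weights: [|f i| |f j|] is at most the half sum of
    [k i j * f i ^+ 2] and [k j i * f j ^+ 2], and by symmetry both halves
    contribute the same row sums. *)
Lemma weighted_schur n (f : 'I_n -> R) (r A k : 'I_n -> 'I_n -> R) (B : 'I_n -> R) :
  (forall i j, `|r i j| <= A i j) -> (forall i j, A i j = A j i) ->
  (forall i j, 0 <= k i j) -> (forall i j, k i j * k j i = 1) ->
  (forall i, \sum_(j < n) k i j * A i j <= B i) ->
  \sum_(i < n) \sum_(j < n) f i * f j * r i j <= \sum_(i < n) f i ^+ 2 * B i.
Proof.
move=> rA Asym k0 k1 rowB.
pose D i j := f i ^+ 2 * (k i j * A i j).
have pt i j : f i * f j * r i j <= 2^-1 * D i j + 2^-1 * D j i.
  have A0 : 0 <= A i j by exact: le_trans (rA i j).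
  apply: (@le_trans _ _ (`|f i| * `|f j| * A i j)).
    rewrite (le_trans (ler_norm _))// !normrM ler_wpM2l ?mulr_ge0//.
  rewrite /D (Asym j i).
  have E : `|f i| * `|f j| <= 2^-1 * (k i j * f i ^+ 2 + k j i * f j ^+ 2).
    rewrite -(real_normK (num_real (f i))) -(real_normK (num_real (f j))).
    exact: weighted_AGM.
  have := ler_wpM2r A0 E; lra.
apply: (@le_trans _ _ (\sum_(i < n) \sum_(j < n) (2^-1 * D i j + 2^-1 * D j i))).
  by apply: ler_sum => i _; apply: ler_sum => j _.
under eq_bigr do rewrite big_split/=.
rewrite big_split/= [X in _ + X]exchange_big/=.
have -> (x : R) : x + x = 2 * x by rewrite mulr_natl mulr2n.
under eq_bigr do rewrite -mulr_sumr.
rewrite -mulr_sumr mulrA divff ?pnatr_eq0// mul1r.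
apply: ler_sum => i _; rewrite -mulr_sumr ler_wpM2l ?sqr_ge0//.
Qed.

End SchurTest.

Section Grid.
Context {R : realType}.
Implicit Types (l : seq R) (C : R -> R -> R).

(** A grid that contains the listed points. Equal consecutive points are allowed,
    so points can be added without a case distinction. *)
Record grid (T : R) (l : seq R) (tau : nat -> R) (N : nat) : Prop := Grid {
  grid0 : tau 0%N = 0;
  gridN : tau N = T;
  grid_nd : forall i j, (i <= j)%N -> tau i <= tau j;
  grid_mem : forall t, t \in l -> exists2 m, (m <= N)%N & tau m = t }.

Lemma grid_exists T l : 0 <= T -> (forall t, t \in l -> 0 <= t <= T) ->
  exists tau N, grid T l tau N.
Proof.
move=> T0 lT; pose g := 0 :: sort <=%R l.
have gT t : t \in g -> t <= T.
  by rewrite inE mem_sort => /predU1P[->//|/lT/andP[]].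
have g_sorted : sorted <=%R g.
  rewrite /= path_min_sorted ?sort_le_sorted//.
  by apply/allP => t; rewrite mem_sort => /lT/andP[].
exists (nth T g), (size g); split => //.
- by rewrite nth_default.
- move=> i j ij; have [jg|jg] := ltnP j (size g); last first.
    rewrite [leRHS]nth_default//.
    by have [ig|ig] := ltnP i (size g); [apply/gT/mem_nth|rewrite nth_default].
  apply: (@sorted_leq_nth _ <=%R _ _ T g) => //; first exact: le_trans.
  by rewrite inE (leq_ltn_trans ij).
- move=> t tl; have tg : t \in g by rewrite inE mem_sort tl orbT.
  by exists (index t g); [rewrite ltnW// index_mem|rewrite nth_index].
Qed.

Lemma telescope_window (h : nat -> R) m1 m2 N : (m1 <= m2)%N -> (m2 <= N)%N ->
  \sum_(i < N) (if (m1 <= i < m2)%N then h i.+1 - h i else 0) = h m2 - h m1.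
Proof.
move=> m12 m2N.
(* clamping the index to the window makes the sum telescope over all of [N] *)
pose g i := h (minn m2 (maxn m1 i)).
rewrite -(big_mkord xpredT (fun i => if (m1 <= i < m2)%N then h i.+1 - h i else 0)).
rewrite (@telescope_sumr_eq _ _ _ g)// => [|i _].
  have -> : g N = h m2 by rewrite /g; congr h; lia.
  by rewrite /g; congr (_ - h _); lia.
rewrite /g; case: ifPn => im.
  by congr (h _ - h _); lia.
have -> : minn m2 (maxn m1 i.+1) = minn m2 (maxn m1 i) by lia.
by rewrite subrr.
Qed.

Section FixGrid.
Variables (T : R) (l : seq R) (tau : nat -> R) (N : nat).
Hypothesis G : grid T l tau N.

Lemma grid_ge0 i : 0 <= tau i.
Proof. by rewrite -(grid0 G) (grid_nd G). Qed.

Lemma grid_step i : tau i <= tau i.+1. Proof. exact: (grid_nd G). Qed.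

Lemma grid_le i : (i <= N)%N -> tau i <= T.
Proof. by move=> iN; rewrite -(gridN G) (grid_nd G). Qed.

Lemma grid_ltn i m : tau i < tau m -> (i < m)%N.
Proof. by move=> im; rewrite ltnNge; apply/negP => /(grid_nd G); rewrite leNgt im. Qed.

(** The partial sums are the values of [h] at [min (tau n) t]: no cell straddles
    [t], which is a point of the grid. *)
Lemma grid_jump (h : R -> R) t : t \in l ->
  \sum_(i < N) (tau i.+1 <= t)%R%:R * (h (tau i.+1) - h (tau i)) = h t - h 0.
Proof.
move=> /(grid_mem G)[m mN tm].
have main n : \sum_(i < n) (tau i.+1 <= t)%R%:R * (h (tau i.+1) - h (tau i)) =
    h (Num.min (tau n) t) - h 0.
  elim: n => [|n IH].
    by rewrite big_ord0 (grid0 G) min_l ?subrr// -tm grid_ge0.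
  rewrite big_ord_recr/= IH; have [nt|nt] := leP (tau n.+1) t.
    rewrite mul1r (min_l (le_trans (grid_step n) nt)).
    by rewrite addrC addrA subrK.
  rewrite mul0r addr0 min_r// -tm (grid_nd G)//.
  by have : (m < n.+1)%N by apply: grid_ltn; rewrite tm.
by rewrite main (gridN G) min_r// -tm grid_le.
Qed.

(** A covariance that vanishes on the axes is the sum of its rectangular
    increments: telescoping in each variable. *)
Lemma grid_bilinear C t t' :
  (forall s, 0 <= s -> C 0 s = 0) -> (forall s, 0 <= s -> C s 0 = 0) ->
  t \in l -> t' \in l ->
  C t t' = \sum_(i < N) \sum_(j < N) (tau i.+1 <= t)%R%:R * (tau j.+1 <= t')%R%:R *
             rect C (tau i) (tau i.+1) (tau j) (tau j.+1).
Proof.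
move=> C0l C0r tl tl'.
have -> : C t t' = C t t' - C 0 t'.
  have [m _ <-] := grid_mem G tl'; by rewrite C0l ?subr0// grid_ge0.
rewrite -(grid_jump (fun s => C s t') tl).
apply: eq_bigr => i _.
pose h u := C (tau i.+1) u - C (tau i) u.
have -> : C (tau i.+1) t' - C (tau i) t' = h t' - h 0 by rewrite /h !C0r ?grid_ge0// !subr0.
rewrite -(grid_jump h tl') mulr_sumr; apply: eq_bigr => j _.
by rewrite mulrA /h /rect; congr (_ * _); ring.
Qed.

Lemma rect_row_window C x y m1 m2 : (m1 <= m2)%N -> (m2 <= N)%N ->
  \sum_(j < N) (if (m1 <= j < m2)%N then rect C x y (tau j) (tau j.+1) else 0) =
  rect C x y (tau m1) (tau m2).
Proof.
move=> m12 m2N.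
rewrite (_ : rect _ _ _ _ _ = (C y (tau m2) - C x (tau m2)) - (C y (tau m1) - C x (tau m1))).
  rewrite -(telescope_window (fun j => C y (tau j) - C x (tau j)) m12 m2N).
  by apply: eq_bigr => j _; case: ifP => // _; rewrite /rect; ring.
by rewrite /rect; ring.
Qed.

Lemma rect_row C x y :
  \sum_(j < N) rect C x y (tau j) (tau j.+1) = rect C x y 0 T.
Proof.
have -> : rect C x y 0 T = rect C x y (tau 0) (tau N) by rewrite (grid0 G) (gridN G).
rewrite -(@rect_row_window C x y 0 N)//.
by apply: eq_bigr => j _; rewrite /= ltn_ord.
Qed.

End FixGrid.
End Grid.

(** * The quadratic form of step functions *)

Section StepForm.
Context {R : realType}.
Local Notation mu := (@lebesgue_measure R).

(** On ]0, T] step functions are left continuous, so they are read off at the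
    right ends of the cells. *)
Definition cell_value (s : step) (u : R) : R := \sum_(p <- s) p.1 * (u <= p.2)%R%:R.

Section OnGrid.
Variables (T : R) (l : seq R) (tau : nat -> R) (N : nat).
Hypothesis G : grid T l tau N.

Lemma step_fun_cell (s : step) i u : (forall p, p \in s -> p.2 \in l) ->
  tau i < u < tau i.+1 -> step_fun s u = cell_value s (tau i.+1).
Proof.
move=> sl /andP[iu ui]; apply: eq_big_seq => p ps; congr (_ * _).
have u0 : 0 <= u by rewrite ltW// (le_lt_trans (grid_ge0 G i)).
rewrite indicE mem_setE/= in_itv/= u0/=; congr (_%:R); congr nat_of_bool.
apply/idP/idP => [up|]; last exact: le_trans (ltW ui).
have [m mN tm] := grid_mem G (sl _ ps); rewrite -tm in up *.
by apply: (grid_nd G); apply: (grid_ltn G); exact: lt_le_trans up.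
Qed.

Lemma step_dot_grid (H K : R) (s : step) : 0 < H < 1 -> 0 < K <= 1 -> 2^-1 < H * K < 1 ->
  (forall p, p \in s -> p.2 \in l) ->
  step_dot H K s s = \sum_(i < N) \sum_(j < N)
    cell_value s (tau i.+1) * cell_value s (tau j.+1) *
    rect (bifbm_cov H K) (tau i) (tau i.+1) (tau j) (tau j.+1).
Proof.
move=> H1 K1 HK1 sl.
have C0l t : 0 <= t -> bifbm_cov H K 0 t = 0 by exact: bifbm_cov0l.
have C0r t : 0 <= t -> bifbm_cov H K t 0 = 0.
  by move=> t0; rewrite bifbm_covC; exact: bifbm_cov0l.
rewrite /step_dot; move: (bifbm_cov H K) C0l C0r => C C0l C0r.
pose r i j := rect C (tau i) (tau i.+1) (tau j) (tau j.+1).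
pose e (p : R * R) i : R := p.1 * (tau i.+1 <= p.2)%R%:R.
transitivity (\sum_(p <- s) \sum_(q <- s) \sum_(i < N) \sum_(j < N) e p i * e q j * r i j).
  apply: eq_big_seq => p ps; apply: eq_big_seq => q qs.
  rewrite (grid_bilinear G C0l C0r (sl _ ps) (sl _ qs)) mulr_sumr.
  apply: eq_bigr => i _; rewrite mulr_sumr; apply: eq_bigr => j _.
  by rewrite /e /r; move: (rect _ _ _ _ _) => z; ring.
under eq_bigr do rewrite exchange_big/=.
rewrite exchange_big/=; apply: eq_bigr => i _.
under eq_bigr do rewrite exchange_big/=.
rewrite exchange_big/=; apply: eq_bigr => j _.
rewrite /cell_value !mulr_suml; apply: eq_bigr => p _.
by rewrite mulr_sumr mulr_suml; apply: eq_bigr => q _.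
Qed.

Lemma grid_integral_le (h : R -> \bar R) n : (n <= N)%N ->
  (forall u, 0 <= h u)%E -> measurable_fun `[0, T] h ->
  (\sum_(i < n) \int[mu]_(u in `]tau i, tau i.+1[) h u <=
    \int[mu]_(u in `]0%R, tau n[) h u)%E.
Proof.
move=> nN h0 mh.
have mh' (A : set R) : A `<=` `[0, T] -> measurable_fun A h.
  by move=> AT; apply: measurable_funS mh.
elim: n nN => [|n IH] nN; first by rewrite big_ord0 integral_ge0.
have nT : tau n <= T by rewrite (grid_le G)// ltnW.
have n1T : tau n.+1 <= T by rewrite (grid_le G).
have n0 := grid_ge0 G n.
have nn := grid_step G n.
rewrite big_ord_recr/=.
apply: (@le_trans _ _ (\int[mu]_(u in `]0%R, tau n[ `|` `]tau n, tau n.+1[) h u)%E).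
  rewrite ge0_integral_setU//=.
  - by apply: leeD; [exact: IH (ltnW nN)|].
  - apply: mh' => u [] /=; rewrite !in_itv/= => /andP[? ?]; apply/andP; split.
    + exact: ltW.
    + by rewrite ltW// (lt_le_trans _ nT).
    + by rewrite ltW// (le_lt_trans n0).
    + by rewrite ltW// (lt_le_trans _ n1T).
  - apply/disj_setPRL => u /=; rewrite !in_itv/= => /andP[un _] /andP[_].
    by rewrite ltNge (ltW un).
apply: ge0_subset_integral => //.
- exact: measurableU.
- apply: mh' => u /=; rewrite !in_itv/= => /andP[? ?]; apply/andP; split; first exact: ltW.
  by rewrite ltW// (lt_le_trans _ n1T).
- move=> u [] /=; rewrite !in_itv/= => /andP[? ?]; apply/andP; split => //.
  + by rewrite (lt_le_trans _ nn).
  + by rewrite (le_lt_trans n0).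
Qed.

End OnGrid.

Lemma measurable_step_fun (s : step) : measurable_fun [set: R] (@step_fun R s).
Proof.
rewrite /step_fun; apply: measurable_sum => p.
by apply: measurable_funM => //; exact: measurable_indic.
Qed.

End StepForm.

Section StepFormBound.
Context {R : realType}.
Local Notation mu := (@lebesgue_measure R).
Variables (H K T : R).
Hypotheses (H1 : 0 < H < 1) (K1 : 0 < K <= 1) (HK1 : 2^-1 < H * K < 1) (T0 : 0 < T).

(** Inside the window the masses of the majorant have row sums of order
    [(beta - alpha) `^ (2 * H * K - 1)]; the weights of Schur's test put the loss of
    all the other pairs of cells on the cells outside the window, where the
    step function is small. *)
Lemma step_dot_le c : 0 < c -> exists2 C : R, 0 <= C & forall alpha beta : R,
  c <= alpha -> alpha < beta -> beta <= T -> exists2 C' : R, 0 <= C' &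
  forall (g : R -> R) (M e : R) (s : step),
  measurable_fun [set: R] g -> (forall u, `|g u| <= M) ->
  (forall u, ~ (alpha <= u <= beta) -> g u = 0) -> step_on T s ->
  (\int[mu]_(u in `[0%R, T]) ((step_fun s u - g u) ^+ 2)%:E <= e%:E)%E ->
  step_dot H K s s <=
    C * (beta - alpha) `^ (2 * H * K - 1) * M ^+ 2 * (beta - alpha) + C' * e.
Proof.
move=> c0; have [C0 hC0] := @major_window_le R H K H1 K1 HK1 c T c0.
pose C2 := `|C0|; pose C1 := 3 * (2 * H * K) * T `^ (2 * H * K - 1).
have HK0 : 0 <= 2 * H * K by case/andP: HK1 => ? _; lra.
have C10 : 0 <= C1 by rewrite mulr_ge0 ?powR_ge0// mulr_ge0.
have C20 : 0 <= C2 by exact: normr_ge0.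
exists (2 * (C2 + C1)); first by rewrite mulr_ge0// addr_ge0.
move=> alpha beta ca ab bT; pose lam := (beta - alpha) `^ (2 * H * K - 1).
have lam0 : 0 < lam by rewrite powR_gt0// subr_gt0.
pose b1 := (C2 + C1) * lam; pose b0 := (1 + lam^-1) * C1.
have b10 : 0 <= b1 by rewrite mulr_ge0 ?addr_ge0 ?(ltW lam0).
have b00 : 0 <= b0 by rewrite mulr_ge0// addr_ge0// invr_ge0 ltW.
exists (2 * (b0 + b1)); first by rewrite mulr_ge0// addr_ge0.
move=> g M e s mg gM g0 sT se.
have al0 : 0 < alpha by exact: lt_le_trans ca.
have be0 : 0 < beta by exact: lt_trans ab.
have aT : alpha <= T by rewrite (le_trans _ bT)// ltW.
pose l := alpha :: beta :: [seq p.2 | p <- s].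
have lT t : t \in l -> 0 <= t <= T.
  rewrite !inE => /or3P[/eqP->|/eqP->|/mapP[p /sT ? ->//]].
  - by rewrite (ltW al0).
  - by rewrite (ltW be0).
have [tau [N G]] := grid_exists (ltW T0) lT.
have [m1 m1N m1E] : exists2 m, (m <= N)%N & tau m = alpha.
  by apply: (grid_mem G); rewrite !inE eqxx.
have [m2 m2N m2E] : exists2 m, (m <= N)%N & tau m = beta.
  by apply: (grid_mem G); rewrite !inE eqxx orbT.
have m12 : (m1 <= m2)%N by apply/ltnW/(grid_ltn G); rewrite m1E m2E.
have sl p : p \in s -> p.2 \in l.
  by move=> ps; rewrite !inE; apply/or3P; apply: Or33; apply: map_f.
rewrite (step_dot_grid G H1 K1 HK1 sl).
pose inw i := (m1 <= i < m2)%N.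
pose w i := tau i.+1 - tau i.
have w0 i : 0 <= w i by rewrite subr_ge0 (grid_step G).
pose f i := cell_value s (tau i.+1).
pose A i j := rect (major_kernel H K) (tau i) (tau i.+1) (tau j) (tau j.+1).
have rA i j : `|rect (bifbm_cov H K) (tau i) (tau i.+1) (tau j) (tau j.+1)| <= A i j.
  by apply: rect_cov_le => //; rewrite ?(grid_step G) ?(grid_ge0 G).
have A0 i j : 0 <= A i j by exact: le_trans (rA i j).
have Asym i j : A i j = A j i.
  have sym u v : major_kernel H K u v = major_kernel H K v u.
    by rewrite /major_kernel /sum_kernel /dist_kernel distrC (addrC (u `^ _)).
  rewrite /A /rect !(sym (tau j)) !(sym (tau j.+1)).
  by move: (major_kernel _ _) => h; ring.
have rowT i : (i < N)%N -> \sum_(j < N) A i j <= C1 * w i.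
  move=> iN; rewrite /A (rect_row G); apply: major_row_le => //.
  - exact: (grid_ge0 G).
  - exact: (grid_step G).
  - exact: (grid_le G).
have rowW i : (i < N)%N -> inw i ->
    \sum_(j < N) (if inw j then A i j else 0) <= C2 * lam * w i.
  move=> iN /andP[m1i im2]; rewrite /A (@rect_row_window R tau N _ _ _ _ _ m12 m2N).
  rewrite m1E m2E (le_trans (hC0 _ _ _ _ ca _ _ _ bT))//.
  - by rewrite -m1E (grid_nd G).
  - exact: (grid_step G).
  - by rewrite -m2E (grid_nd G).
  - by rewrite ler_wpM2r ?w0// ler_wpM2r ?(ltW lam0)// ler_norm.
(* pairs of a cell inside and a cell outside the window: the weight [lam] goes to
   the inside, the weight [lam^-1] to the outside *)
pose kk i j : R := if inw i then (if inw j then 1 else lam)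
                   else (if inw j then lam^-1 else 1).
pose b i := if inw i then b1 else b0.
have b_ge0 i : 0 <= b i by rewrite /b; case: ifP.
apply: (@le_trans _ _ (\sum_(i < N) f i ^+ 2 * (b i * w i))).
  apply: (@weighted_schur R N (fun i => f i) _ (fun i j => A i j) (fun i j => kk i j)) => //.
  - move=> i j; rewrite /kk; case: ifP; case: ifP => _ _ //; first exact: ltW.
    by rewrite invr_ge0 ltW.
  - move=> i j; rewrite /kk; case: ifP; case: ifP => _ _; rewrite ?mulr1 ?divff ?mulVf//;
    exact: lt0r_neq0.
  - move=> i; rewrite /b; case: ifPn => ii.
      apply: (@le_trans _ _ (\sum_(j < N) ((if inw j then A i j else 0) + lam * A i j))).
        apply: ler_sum => j _; rewrite /kk ii; case: ifPn => jj.
          by rewrite mul1r lerDl mulr_ge0// ltW.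
        by rewrite add0r.
      rewrite big_split/= -mulr_sumr.
      apply: (le_trans (lerD (rowW _ (ltn_ord i) ii) (ler_wpM2l (ltW lam0) (rowT _ (ltn_ord i))))).
      by rewrite /b1 le_eqVlt; apply/orP; left; apply/eqP; ring.
    apply: (@le_trans _ _ (\sum_(j < N) ((1 + lam^-1) * A i j))).
      apply: ler_sum => j _; rewrite /kk (negbTE ii); apply: ler_wpM2r => //.
      by case: ifP => _; rewrite ?lerDl ?lerDr ?invr_ge0// ltW.
    rewrite -mulr_sumr /b0 -mulrA ler_wpM2l//; last exact: rowT.
    by rewrite addr_ge0// invr_ge0 ltW.
have mstep : measurable_fun [set: R] (fun u => (step_fun s u - g u) ^+ 2).
  apply: measurable_funX; apply: measurable_funB => //.
  exact: measurable_step_fun.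
have mE : measurable_fun [set: R] (fun u => ((step_fun s u - g u) ^+ 2)%:E).
  exact/measurable_EFinP.
(* open cells, since an end of the window may belong to the support of [g] *)
pose E i := (\int[mu]_(u in `]tau i, tau i.+1[) ((step_fun s u - g u) ^+ 2)%:E)%E.
have sumE : (\sum_(i < N) E i <= e%:E)%E.
  apply: le_trans se; apply: (le_trans (grid_integral_le G (leqnn N) _ _)).
  - by move=> u; rewrite lee_fin sqr_ge0.
  - exact: measurable_funTS mE.
  - rewrite (gridN G); apply: ge0_subset_integral.
    + exact: measurable_itv.
    + exact: measurable_itv.
    + exact: measurable_funTS mE.
    + by move=> u _; rewrite lee_fin sqr_ge0.
    + exact: subset_itv_oo_cc.
have E0 i : (0 <= E i)%E by apply: integral_ge0 => u _; rewrite lee_fin sqr_ge0.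
have cellI i (r : R) : (\int[mu]_(u in `]tau i, tau i.+1[) r%:E = (r * w i)%:E)%E.
  rewrite integral_cst//= lebesgue_measure_itv/= lte_fin.
  case: ifPn => [_|]; first by rewrite -EFinD -EFinM.
  by rewrite -leNgt /w => ii; rewrite (_ : tau i.+1 - tau i = 0) ?mulr0 ?mule0//;
     apply/eqP; rewrite subr_eq0 eq_le ii (grid_step G).
have cell i : (i < N)%N -> ((f i ^+ 2 * w i)%:E <=
    2%:E * E i + (if inw i then 2 * M ^+ 2 * w i else 0)%:E)%E.
  move=> iN.
  have -> : ((if inw i then 2 * M ^+ 2 * w i else 0) =
     (if inw i then 2 * M ^+ 2 else 0) * w i)%R by case: ifP; rewrite ?mul0r.
  rewrite -!cellI /E -ge0_integralZl; last 4 first.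
  - exact: measurable_itv.
  - exact: measurable_funTS mE.
  - by move=> u _; rewrite lee_fin sqr_ge0.
  - by rewrite lee_fin.
  have M0 : 0 <= (if inw i then 2 * M ^+ 2 else 0) by case: ifP => // _; rewrite mulr_ge0 ?sqr_ge0.
  have mE2 : measurable_fun [set: R] (fun u => (2%:E * ((step_fun s u - g u) ^+ 2)%:E)%E).
    by apply/measurable_EFinP; apply: measurable_funM.
  rewrite -ge0_integralD; last 5 first.
  - exact: measurable_itv.
  - by move=> u _; rewrite -EFinM lee_fin mulr_ge0 ?sqr_ge0.
  - exact: measurable_funTS mE2.
  - by move=> u _; rewrite lee_fin.
  - exact: measurable_cst.
  apply: ge0_le_integral.
  - exact: measurable_itv.
  - by move=> u _; rewrite lee_fin sqr_ge0.
  - exact: measurable_cst.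
  - by apply: measurable_funTS; apply: emeasurable_funD => //; exact: measurable_cst.
  move=> u; rewrite /= in_itv/= => ui.
  rewrite -EFinM -EFinD lee_fin /f -(step_fun_cell G sl ui).
  case: ifPn => ii.
    have g2 : g u ^+ 2 <= M ^+ 2.
      by rewrite -(real_normK (num_real (g u))) lerXn2r ?nnegrE// (le_trans _ (gM u)).
    move: (step_fun s u) (g u) g2 => x y g2.
    have : 0 <= (x - 2 * y) ^+ 2 by rewrite sqr_ge0.
    have -> : (x - 2 * y) ^+ 2 = 2 * (x - y) ^+ 2 + 2 * y ^+ 2 - x ^+ 2 by ring.
    lra.
  rewrite addr0 g0 ?subr0 ?ler_peMl ?sqr_ge0 ?ler1n// => /andP[au ub].
  move/negP: ii; apply; apply/andP; split.
    rewrite leqNgt; apply/negP => im1; case/andP: ui => _; rewrite ltNge.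
    by move/negP; apply; rewrite (le_trans _ au)// -m1E (grid_nd G).
  rewrite ltnNge; apply/negP => m2i; case/andP: ui => + _; rewrite ltNge.
  by move/negP; apply; rewrite (le_trans ub)// -m2E (grid_nd G).
have Efin i : (i < N)%N -> E i \is a fin_num.
  move=> iN; rewrite ge0_fin_numE//; apply: (@le_lt_trans _ _ e%:E); last exact: ltry.
  apply: le_trans sumE; rewrite (bigD1 (Ordinal iN))//= leeDl// sume_ge0//.
have sumE' : \sum_(i < N) fine (E i) <= e.
  rewrite -lee_fin -sumEFin; apply: le_trans sumE; apply: lee_sum => i _.
  by rewrite fineK// Efin.
apply: (@le_trans _ _ (\sum_(i < N) (2 * (b0 + b1) * fine (E i) +
    (if inw i then 2 * b1 * M ^+ 2 * w i else 0)))).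
  apply: ler_sum => i _.
  have := cell i (ltn_ord i); rewrite -[X in (_ * X + _)%E](fineK (Efin _ (ltn_ord i))).
  rewrite -EFinM -EFinD lee_fin => /(ler_wpM2l (b_ge0 i)).
  have -> : b i * (f i ^+ 2 * w i) = f i ^+ 2 * (b i * w i) by ring.
  move/le_trans; apply; rewrite mulrDr lerD//.
    rewrite mulrCA -[leRHS]mulrA ler_wpM2l// ler_wpM2r ?fine_ge0//.
    by rewrite /b; case: ifP; rewrite ?lerDl ?lerDr.
  rewrite /b; case: ifP; rewrite ?mulr0// => _.
  by rewrite le_eqVlt; apply/orP; left; apply/eqP; ring.
rewrite big_split/= -mulr_sumr addrC lerD//; last first.
  by rewrite ler_wpM2l// mulr_ge0// addr_ge0.
have -> : 2 * (C2 + C1) * (beta - alpha) `^ (2 * H * K - 1) * M ^+ 2 * (beta - alpha) =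
   2 * b1 * M ^+ 2 * (tau m2 - tau m1) by rewrite m1E m2E /b1 -/lam; ring.
rewrite -(telescope_window tau m12 m2N) mulr_sumr; apply: ler_sum => i _.
by rewrite /inw; case: ifP => // _; rewrite mulr0.
Qed.

End StepFormBound.

(** * Second moments of Wiener integrals *)

Lemma cvge0_lt {R : realType} (u : nat -> \bar R) (e : R) : 0 < e ->
  u n @[n --> \oo] --> 0%E -> \forall n \near \oo, (u n < e%:E)%E.
Proof.
move=> e0 /fine_cvgP[ufin /cvgrPdist_lt/(_ e e0) ue].
near=> n; have un : u n \is a fin_num by near: n.
rewrite -(fineK un) lte_fin; have : `|0 - (fine \o u) n| < e by near: n.
by rewrite sub0r normrN => /ltr_normlW.
Unshelve. all: by end_near. Qed.

Section SecondMoments.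
Context {R : realType} {d : measure_display} {Omega : measurableType d}.
Variable P : probability Omega R.

Lemma expectation_sqrD_le (f g : Omega -> R) :
  measurable_fun setT f -> measurable_fun setT g ->
  ('E_P[(fun w => (f w + g w) ^+ 2)%R] <=
   2%:E * 'E_P[(fun w => f w ^+ 2)%R] + 2%:E * 'E_P[(fun w => g w ^+ 2)%R])%E.
Proof.
move=> mf mg; rewrite unlock.
have mX (h : Omega -> R) : measurable_fun setT h ->
    measurable_fun setT (fun w => (h w ^+ 2)%:E).
  by move=> mh; apply/measurable_EFinP; exact: measurable_funX.
have m2X (h : Omega -> R) : measurable_fun setT h ->
    measurable_fun setT (fun w => (2%:E * (h w ^+ 2)%:E)%E).
  by move=> mh; apply: measurable_funeM; exact: mX.
have pos (h : Omega -> R) w : (0 <= (h w ^+ 2)%:E)%E by rewrite lee_fin sqr_ge0.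
have pos2 (h : Omega -> R) w : (0 <= 2%:E * (h w ^+ 2)%:E)%E by rewrite mule_ge0.
rewrite -!ge0_integralZl//; try exact: mX.
rewrite -ge0_integralD//; try exact: m2X.
apply: ge0_le_integral => //.
- by move=> w _; rewrite lee_fin sqr_ge0.
- exact: (mX (fun w => f w + g w)%R (measurable_funD mf mg)).
- by apply: emeasurable_funD; exact: m2X.
- move=> w _; rewrite -!EFinM -EFinD lee_fin.
  have : 0 <= (f w - g w) ^+ 2 by rewrite sqr_ge0.
  have -> : (f w - g w) ^+ 2 = 2 * f w ^+ 2 + 2 * g w ^+ 2 - (f w + g w) ^+ 2 by ring.
  by rewrite subr_ge0.
Qed.

Variables (H K T : R) (W : R -> {RV P >-> R}).
Hypothesis BW : bifractional_brownian_motion H K W.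

Lemma bifbm_moment s t : 0 <= s -> 0 <= t ->
  (\int[P]_w (W s w * W t w)%:E)%E = (bifbm_cov H K s t)%:E.
Proof.
move=> s0 t0; case: BW => _ EW cov; rewrite -cov// covariance.unlock (EW _ s0) (EW _ t0) expectation.unlock.
apply: eq_integral => w _.
change ((W s w * W t w)%:E = ((W s w - 0) * (W t w - 0))%:E).
by rewrite !subr0.
Qed.

Lemma bifbm_integrable s t : 0 <= s -> 0 <= t ->
  P.-integrable setT (fun w => (W s w * W t w)%:E).
Proof.
move=> s0 t0.
have sq u : 0 <= u -> P.-integrable setT (fun w => (W u w ^+ 2)%:E).
  move=> u0; apply/integrableP; split.
    by apply/measurable_EFinP; exact: measurable_funX.
  under eq_integral do rewrite gee0_abs ?lee_fin ?sqr_ge0// expr2.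
  by rewrite bifbm_moment// ltry.
apply: (@le_integrable _ _ _ _ _ _ _ (fun w => ((W s w ^+ 2)%:E + (W t w ^+ 2)%:E)%E)) => //.
- by apply/measurable_EFinP; exact: measurable_funM.
- move=> w _; rewrite -EFinD !abse_EFin lee_fin [leRHS]ger0_norm ?addr_ge0 ?sqr_ge0//.
  move: (W s w) (W t w) => x y; rewrite ler_norml.
  have : 0 <= (x - y) ^+ 2 by rewrite sqr_ge0.
  have : 0 <= (x + y) ^+ 2 by rewrite sqr_ge0.
  by rewrite !expr2 => ? ?; apply/andP; split; nra.
- by apply: integrableD => //; exact: sq.
Qed.

Lemma step_integral_moment (s : step) : step_on T s ->
  'E_P[(fun w => step_integral W s w ^+ 2)%R]%E = (step_dot H K s s)%:E.
Proof.
move=> sT; rewrite unlock /step_integral.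
have s0 p : p \in s -> 0 <= p.2 by move=> /sT/andP[].
rewrite /step_dot -sumEFin.
transitivity (\int[P]_w \sum_(p <- s) \sum_(q <- s)
   (if (p \in s) && (q \in s) then (p.1 * q.1)%:E * (W p.2 w * W q.2 w)%:E else 0))%E.
  apply: eq_integral => w _.
  rewrite expr2 mulr_suml -sumEFin; apply: eq_big_seq => p ps.
  rewrite mulr_sumr -sumEFin; apply: eq_big_seq => q qs.
  by rewrite ps qs/= -EFinM; congr EFin; ring.
have ipq p q : P.-integrable setT (fun w => if (p \in s) && (q \in s)
    then (p.1 * q.1)%:E * (W p.2 w * W q.2 w)%:E else 0)%E.
  case: (boolP ((p \in s) && (q \in s))) => [/andP[ps qs]|_]; last exact: integrable0.
  by apply: integrableZl => //; apply: bifbm_integrable; exact: s0.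
rewrite integral_sum//=; last by move=> p; apply: integrable_sum => // q.
apply: eq_big_seq => p ps; rewrite integral_sum//= -sumEFin.
apply: eq_big_seq => q qs; rewrite ps qs/= integralZl//; last exact: bifbm_integrable (s0 _ ps) (s0 _ qs).
by rewrite bifbm_moment ?s0.
Qed.

Lemma measurable_step_integral (s : step) : measurable_fun setT (step_integral W s).
Proof.
rewrite /step_integral; apply: measurable_sum => p.
exact: measurable_funM.
Qed.

Hypotheses (H1 : 0 < H < 1) (K1 : 0 < K <= 1) (HK1 : 2^-1 < H * K < 1) (T0 : 0 < T).

(** Over a window of length [l] the second moment of a Wiener integral scales like
    [l `^ (2 * H * K)], the variance of an increment over the window, and not like
    [l]. *)
Lemma wiener_integral_moment_le c : 0 < c -> exists2 C : R, 0 <= C &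
  forall (alpha beta M : R) (g : R -> R) (J : {RV P >-> R}),
  c <= alpha -> alpha < beta -> beta <= T ->
  measurable_fun [set: R] g -> (forall u, `|g u| <= M) ->
  (forall u, ~ (alpha <= u <= beta) -> g u = 0) ->
  wiener_integral H K T W g J ->
  ('E_P[(fun w => J w ^+ 2)%R] <=
    (C * (beta - alpha) `^ (2 * H * K) * M ^+ 2)%:E)%E.
Proof.
move=> c0; have [C C0 hC] := step_dot_le H1 K1 HK1 T0 c0.
exists (2 * C); first by rewrite mulr_ge0.
move=> alpha beta M g J ca ab bT mg gM g0 [s_ [son _ sg] sJ].
have [C' C'0 {}hC] := hC alpha beta ca ab bT.
apply/lee_addgt0Pr => z z0.
pose e := z / (4 * (C' + 1)); pose h := z / 4.
have C'1 : 0 < C' + 1 by rewrite ltr_wpDl.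
have e0 : 0 < e by rewrite divr_gt0// mulr_gt0.
have h0 : 0 < h by rewrite divr_gt0.
have [n [/ltW gn /ltW Jn]] : exists n,
   (\int[lebesgue_measure]_(u in `[0%R, T]) ((step_fun (s_ n) u - g u) ^+ 2)%:E < e%:E)%E /\
   ('E_P[(fun w => (step_integral W (s_ n) w - J w) ^+ 2)%R] < h%:E)%E.
  near \oo => n; exists n; split; near: n; exact: cvge0_lt.
have := @expectation_sqrD_le (fun w => J w - step_integral W (s_ n) w)
   (step_integral W (s_ n)) (measurable_funB (measurable_funPT J) (measurable_step_integral _))
   (measurable_step_integral _).
have -> : (fun w => (J w - step_integral W (s_ n) w + step_integral W (s_ n) w) ^+ 2) =
          (fun w => J w ^+ 2) by apply/funext => w; rewrite subrK.
have -> : (fun w => (J w - step_integral W (s_ n) w) ^+ 2) =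
          (fun w => (step_integral W (s_ n) w - J w) ^+ 2).
  by apply/funext => w; rewrite -sqrrN opprB.
move/le_trans; apply; rewrite step_integral_moment//.
apply: (@le_trans _ _ (2%:E * h%:E + 2%:E * (step_dot H K (s_ n) (s_ n))%:E)%E).
  by rewrite leeD// lee_wpmul2l ?lee_fin.
have sd := hC g M e (s_ n) mg gM g0 (son n) gn.
rewrite -!EFinM -!EFinD lee_fin.
have E1 : C' * e <= h.
  rewrite /e /h invfM mulrCA [X in _ <= X]mulrC mulrCA -[leRHS]mulr1 mulrCA.
  rewrite mulrAC -mulrA mulrC.
  have : C' / (C' + 1) <= 1 by rewrite ler_pdivrMr// mul1r lerDl.
  by move=> q; nra.
have ba : 0 < beta - alpha by rewrite subr_gt0.
have E2 : (beta - alpha) `^ (2 * H * K) = (beta - alpha) `^ (2 * H * K - 1) * (beta - alpha).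
  rewrite [RHS]mulrC mulr_powRB1 ?(ltW ba)//.
  by case/andP: HK1 => HK0 _; rewrite -mulrA mulr_gt0// (lt_trans _ HK0).
have -> : 2 * C * (beta - alpha) `^ (2 * H * K) * M ^+ 2 =
  2 * (C * (beta - alpha) `^ (2 * H * K - 1) * M ^+ 2 * (beta - alpha)).
  by rewrite E2; move: (_ `^ _) => x; ring.
have -> : z = 4 * h by rewrite /h mulrC divfK// pnatr_eq0.
move: sd; move: (C * _ * _ * _) (step_dot _ _ _ _) (C' * e) E1 => x y v vh yx.
lra.
Unshelve. all: by end_near. Qed.

End SecondMoments.

(** * Uniform Taylor expansions *)

Section TaylorFamilies.
Context {R : realType}.
Implicit Types (f g : R -> R) (p q : {poly R}) (r C h x : R) (n : nat).

Lemma MVT_centered f f' r h : (forall x, `|x| < r -> is_derive x 1 f (f' x)) ->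
  `|h| < r -> exists2 x, `|x| <= `|h| & f h - f 0 = f' x * h.
Proof.
move=> df hr.
have cont a b : (forall x, a <= x <= b -> `|x| < r) -> {within `[a, b], continuous f}.
  move=> ab; apply: continuous_in_subspaceT => x; rewrite inE/= in_itv/= => /ab xr.
  apply: differentiable_continuous; apply/derivable1_diffP.
  by apply: ex_derive; exact: df.
have [h0|h0] := leP 0 h.
  have small x : 0 <= x <= h -> `|x| <= `|h|.
    by move=> /andP[x0 xh]; rewrite !ger0_norm.
  have [x|//|x] := @MVT_segment R f f' 0 h h0.
  - by rewrite in_itv/= => /andP[/ltW x0 /ltW xh]; apply: df; rewrite (le_lt_trans (small x _)) ?x0.
  - by apply: cont => x xh; rewrite (le_lt_trans (small x _)).
  by rewrite in_itv/= subr0 => /small xh ->; exists x.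
have small x : h <= x <= 0 -> `|x| <= `|h|.
  by move=> /andP[hx x0]; rewrite !ler0_norm ?(ltW h0)// lerN2.
have [x|//|x] := @MVT_segment R f f' h 0 (ltW h0).
- by rewrite in_itv/= => /andP[/ltW hx /ltW x0]; apply: df; rewrite (le_lt_trans (small x _)) ?x0 ?hx.
- by apply: cont => x xh; rewrite (le_lt_trans (small x _)).
rewrite in_itv/= sub0r => /small xh E; exists x => //.
by rewrite -opprB E mulrN opprK.
Qed.

Definition antideriv c q : {poly R} :=
  \poly_(j < (size q).+1) (if j is j'.+1 then q`_j' / j%:R else c).

Lemma size_antideriv c q : (size (antideriv c q) <= (size q).+1)%N.
Proof. exact: size_poly. Qed.

Lemma coef_antideriv c q j :
  (antideriv c q)`_j = if j is j'.+1 then q`_j' / j%:R else c.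
Proof.
rewrite coef_poly; case: j => // j; rewrite ltnS; case: ltnP => // qj.
by rewrite nth_default ?mul0r.
Qed.

Lemma deriv_antideriv c q : (antideriv c q)^`() = q.
Proof.
apply/polyP => j; rewrite coef_deriv coef_antideriv -[LHS]mulr_natr divfK//.
Qed.

Lemma horner0_antideriv c q : (antideriv c q).[0] = c.
Proof. by rewrite horner_coef0 coef_antideriv. Qed.

(** Taylor's formula is integrated one degree at a time: a polynomial
    approximation of the derivative gives one of the function. *)
Lemma antideriv_approx f f' r n C q : 0 <= C ->
  (forall x, `|x| < r -> is_derive x 1 f (f' x)) ->
  (forall h, `|h| < r -> `|f' h - q.[h]| <= C * `|h| ^+ n) ->
  forall h, `|h| < r -> `|f h - (antideriv (f 0) q).[h]| <= C * `|h| ^+ n.+1.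
Proof.
move=> C0 df f'q h hr; set p := antideriv _ _.
have dp x : is_derive x 1 (horner p) q.[x].
  apply: DeriveDef; first exact: derivable_horner.
  by rewrite -derive1E -derivE deriv_antideriv.
have de x : `|x| < r -> is_derive x 1 (fun x => f x - p.[x]) (f' x - q.[x]).
  by move=> xr; have ? := df _ xr; apply: is_deriveB.
have [x xh] := MVT_centered de hr.
rewrite horner0_antideriv subrr subr0 => ->.
rewrite normrM exprSr mulrA ler_wpM2r//.
rewrite (le_trans (f'q x (le_lt_trans xh hr)))// ler_wpM2l// lerXn2r ?nnegrE//.
Qed.

Lemma horner_bound p n C h : 0 <= C -> (size p <= n)%N -> (forall j, `|p`_j| <= C) ->
  `|h| <= 1 -> `|p.[h]| <= n%:R * C.
Proof.
move=> C0 pn pC h1; rewrite (horner_coef_wide _ pn) (le_trans (ler_norm_sum _ _ _))//.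
rewrite -[n in leRHS]card_ord -sum1_card natr_sum mulr_suml; apply: ler_sum => j _.
by rewrite mul1r normrM -[C]mulr1 ler_pM// normrX exprn_ile1.
Qed.

(** A polynomial of bounded degree that is bounded on a finite set of
    interpolation points has bounded coefficients. *)
Lemma coef_bound n (B r : R) : 0 < r -> 0 <= B -> exists2 C : R, 0 <= C & forall p,
  (size p <= n)%N -> (forall h, `|h| < r -> `|p.[h]| <= B) -> forall j, `|p`_j| <= C.
Proof.
move=> r0 B0; pose a : 'rV[R]_n := \row_(j < n) (r * j%:R / n.+1%:R).
pose V := Vandermonde n a.
have Vu : V \in unitmx.
  rewrite unitmxE det_Vandermonde unitfE; apply/prodf_neq0 => i _.
  apply/prodf_neq0 => j ij; rewrite !mxE subr_eq0 gt_eqF//.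
  by rewrite -!mulrA ltr_pM2l// ltr_pM2r ?invr_gt0 ?ltr0n// ltr_nat.
exists (B * \sum_i \sum_j `|invmx V i j|).
  by rewrite mulr_ge0// sumr_ge0// => i _; rewrite sumr_ge0.
move=> p pn pB j; have [nj|jn] := leqP n j.
  rewrite nth_default ?(leq_trans pn)// normr0 mulr_ge0// sumr_ge0// => i _.
  by rewrite sumr_ge0.
pose c : 'rV[R]_n := \row_(i < n) p`_i.
have cV i : (c *m V) 0 i = p.[a 0 i].
  rewrite mxE (horner_coef_wide _ pn); apply: eq_bigr => k _.
  by rewrite !mxE.
have ar i : `|a 0 i| < r.
  rewrite mxE ger0_norm ?divr_ge0 ?mulr_ge0 ?(ltW r0)//.
  by rewrite ltr_pdivrMr// ltr_pM2l// ltr_nat ltnS ltnW.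
have -> : p`_j = c 0 (Ordinal jn) by rewrite mxE.
rewrite -(mulmxK Vu c) mxE (le_trans (ler_norm_sum _ _ _))// mulr_sumr.
apply: ler_sum => i _; rewrite normrM cV; apply: ler_pM => //; first exact: pB.
by rewrite (bigD1 (Ordinal jn))//= lerDl sumr_ge0.
Qed.

Section Families.
Context {I : Type}.
Variables (r : R) (D : set I).
Hypotheses (r0 : 0 < r) (r1 : r <= 1).
Implicit Types F G : I -> R -> R.

(** Taylor expansions at the origin whose constants do not depend on the index.
    The polynomial is left unspecified: products and primitives then need no
    formula for higher derivatives. *)
Definition taylor_family n F := exists2 C : R, 0 <= C & forall i, D i ->
  exists p, [/\ (size p <= n)%N, forall j, `|p`_j| <= C &
    forall h, `|h| < r -> `|F i h - p.[h]| <= C * `|h| ^+ n].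

Let hr1 h : `|h| < r -> `|h| <= 1. Proof. by move/ltW/le_trans; apply. Qed.

Lemma taylor_family0 F (C : R) : 0 <= C ->
  (forall i h, D i -> `|h| < r -> `|F i h| <= C) -> taylor_family 0 F.
Proof.
move=> C0 FC; exists C => // i Di; exists 0; split=> [|j|h hr].
- by rewrite size_poly0.
- by rewrite coef0 normr0.
- by rewrite horner0 subr0 mulr1 FC.
Qed.

Lemma truncate_approx n m C p f : 0 <= C -> (size p <= n + m)%N ->
  (forall j, `|p`_j| <= C) ->
  (forall h, `|h| < r -> `|f h - p.[h]| <= C * `|h| ^+ n) ->
  forall h, `|h| < r -> `|f h - (take_poly n p).[h]| <= (C + m%:R * C) * `|h| ^+ n.
Proof.
move=> C0 pnm pC fp h hr.
have E : p.[h] = (take_poly n p).[h] + (drop_poly n p).[h] * h ^+ n.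
  rewrite -{1}(poly_take_drop n p) hornerD hornerM hornerXn//.
have -> : f h - (take_poly n p).[h] = (f h - p.[h]) + (drop_poly n p).[h] * h ^+ n.
  by rewrite E; ring.
rewrite (le_trans (ler_normD _ _))// mulrDl lerD ?fp// normrM normrX ler_wpM2r ?exprn_ge0//.
apply: horner_bound => //; last exact: hr1.
- by rewrite size_drop_poly leq_subLR.
- by move=> j; rewrite coef_drop_poly.
Qed.

Lemma taylor_familyW n F : taylor_family n.+1 F -> taylor_family n F.
Proof.
case=> C C0 FC; exists (C + 1%:R * C); first by rewrite addr_ge0// mulr_ge0.
move=> i /FC[p [pn pC Fp]]; exists (take_poly n p); split.
- exact: size_take_poly.
- move=> j; rewrite coef_take_poly; case: ifP => _.
    by rewrite (le_trans (pC j))// lerDl mulr_ge0.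
  by rewrite normr0 addr_ge0// mulr_ge0.
- apply: truncate_approx => //; first by rewrite addn1.
  move=> h hr; rewrite (le_trans (Fp h hr))// ler_wpM2l// exprSr.
  by rewrite ler_piMr ?exprn_ge0// hr1.
Qed.

(** The product of the polynomials, truncated: its high-degree part is of the
    order of the error. *)
Lemma taylor_familyM n F G : taylor_family n F -> taylor_family n G ->
  taylor_family n (fun i h => F i h * G i h).
Proof.
case=> C C0 FC [C' C'0 GC].
pose N : R := n%:R; have N0 : 0 <= N by rewrite ler0n.
pose B := C * (N * C' + C') + (N * C) * C' + (n + n)%:R * (C * C').
have CC0 : 0 <= C * C' by rewrite mulr_ge0.
have B1 : C * (N * C' + C') + (N * C) * C' <= B by rewrite lerDl mulr_ge0 ?ler0n.
have B2 : (n + n)%:R * (C * C') <= B.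
  by rewrite lerDr !(addr_ge0, mulr_ge0).
have B0 : 0 <= B by apply: le_trans B2; rewrite mulr_ge0 ?ler0n.
exists (B + n%:R * B); first by rewrite addr_ge0// mulr_ge0.
move=> i Di; have [p [pn pC Fp]] := FC i Di; have [q [qn qC Gq]] := GC i Di.
have pqn : (size (p * q)%R <= n + n)%N.
  by rewrite (leq_trans (size_polyMleq p q))// (leq_trans (leq_pred _))// leq_add.
have pqC j : `|(p * q)`_j| <= B.
  have [nj|jn] := leqP (n + n) j.
    by rewrite nth_default ?normr0// (leq_trans pqn).
  apply: le_trans B2; rewrite coefM (le_trans (ler_norm_sum _ _ _))//.
  apply: (@le_trans _ _ (\sum_(k < j.+1) C * C')).
    by apply: ler_sum => k _; rewrite normrM ler_pM.
  rewrite sumr_const card_ord -[_ *+ _]mulr_natl ler_wpM2r// ler_nat.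
  exact: jn.
exists (take_poly n (p * q)); split.
- exact: size_take_poly.
- move=> j; rewrite coef_take_poly; case: ifP => _.
    by rewrite (le_trans (pqC j))// lerDl mulr_ge0.
  by rewrite normr0 addr_ge0// mulr_ge0.
- apply: truncate_approx => // h hr; have h1 := hr1 hr.
  have hn0 : 0 <= `|h| ^+ n by exact: exprn_ge0.
  have hn1 : `|h| ^+ n <= 1 by rewrite exprn_ile1.
  have pB := horner_bound C0 pn pC h1; have qB := horner_bound C'0 qn qC h1.
  have Fh := Fp h hr; have Gh := Gq h hr.
  have GB : `|G i h| <= N * C' + C'.
    rewrite -[G i h](subrK q.[h]) (le_trans (ler_normD _ _))// addrC lerD//.
    by rewrite (le_trans Gh)// ler_piMr.
  rewrite hornerM.
  have -> : F i h * G i h - p.[h] * q.[h] =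
    (F i h - p.[h]) * G i h + p.[h] * (G i h - q.[h]) by ring.
  apply: (@le_trans _ _ ((C * (N * C' + C') + (N * C) * C') * `|h| ^+ n)).
    rewrite (le_trans (ler_normD _ _))// !normrM mulrDl; apply: lerD.
      by rewrite mulrAC ler_pM.
    by rewrite -mulrA ler_pM.
  by rewrite ler_wpM2r.
Qed.

Lemma taylor_family_deriv n F F' (C0 : R) : 0 <= C0 ->
  (forall i, D i -> `|F i 0| <= C0) ->
  (forall i h, D i -> `|h| < r -> is_derive h 1 (F i) (F' i h)) ->
  taylor_family n F' -> taylor_family n.+1 F.
Proof.
move=> C00 F0 dF [C Cge0 F'C]; exists (C + C0); first exact: addr_ge0.
move=> i Di; have [q [qn qC F'q]] := F'C i Di.
exists (antideriv (F i 0) q); split.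
- by rewrite (leq_trans (size_antideriv _ _)).
- move=> [|j]; rewrite coef_antideriv.
    by rewrite (le_trans (F0 i Di))// lerDr.
  have CC : C <= C + C0 by rewrite lerDl.
  apply: le_trans CC; rewrite normrM -[leRHS]mulr1 ler_pM// ger0_norm ?invr_ge0// invf_le1 ?ltr0n//.
  by rewrite ler1n.
- move=> h hr; apply: (@le_trans _ _ (C * `|h| ^+ n.+1)).
    exact: (antideriv_approx Cge0 (fun x => dF i x Di) F'q).
  by rewrite ler_wpM2r ?exprn_ge0// lerDl.
Qed.

End Families.
End TaylorFamilies.

(** * Smoothness of the multiplier and of the limit solution *)

Section SmoothClass.
Context {R : realType}.
Local Notation mu := (@lebesgue_measure R).
Implicit Types (theta : R -> R) (t h x y r : R).

Lemma derive1n_derive1 i (f : R -> R) : derive1n i (derive1 f) = derive1n i.+1 f.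
Proof. by rewrite /derive1n iterSr. Qed.

Lemma is_derive_shift (f : R -> R) (df t x : R) :
  is_derive (t + x) 1 f df -> is_derive x 1 (fun h => f (t + h)) df.
Proof.
rewrite addrC => fd; have sh : is_derive x 1 (fun h : R => h + t) 1.
  by apply: is_derive_eq; rewrite addr0.
have := @is_derive1_comp R f (fun h => h + t) x _ _ fd sh; rewrite mulr1.
by congr is_derive; apply/funext => h /=; rewrite addrC.
Qed.

Lemma taylor_lipschitz (m : nat) (L1 : R) theta t : 0 <= L1 ->
  (forall i x, (i < m)%N -> derivable (derive1n i theta) x 1) ->
  (forall x y, `|derive1n m theta x - derive1n m theta y| <= L1 * `|x - y|) ->
  exists p : {poly R}, (size p <= m.+1)%N /\
    forall h, `|theta (t + h) - p.[h]| <= L1 * `|h| ^+ m.+1.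
Proof.
move=> L10; elim: m theta => [|m IH] theta dth lip.
  exists (theta t)%:P; split=> [|h]; first exact: size_polyC_leq1.
  rewrite hornerC; have := lip (t + h) t.
  by rewrite addrAC subrr add0r expr1.
have [||q [qm qE]] := IH (derive1 theta).
- by move=> i x im; rewrite derive1n_derive1; exact: dth.
- by move=> x y; rewrite !derive1n_derive1.
exists (antideriv (theta (t + 0)) q); split=> [|h].
  by rewrite (leq_trans (size_antideriv _ _)).
apply: (@antideriv_approx _ (fun h => theta (t + h)) (fun h => derive1 theta (t + h))
  (`|h| + 1)) => //; last by rewrite ltrDl.
move=> x _; apply: is_derive_shift.
by rewrite derive1E; apply: derivableP; exact: (dth 0%N).
Qed.

Lemma derivable1_continuous theta : (forall x, derivable theta x 1) -> continuous theta.
Proof.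
move=> d x; apply: differentiable_continuous; apply/derivable1_diffP; exact: d.
Qed.

Section LimitSolution.
Variables (x0 L : R) (theta : R -> R).
Hypotheses (tc : continuous theta) (tL : forall x, `|theta x| <= L).

Lemma integrable_segment (f : R -> R) (x y : R) : {within `[x, y], continuous f} ->
  mu.-integrable `[x, y] (EFin \o f).
Proof.
by move=> fc; apply: continuous_compact_integrable => //; exact: segment_compact.
Qed.

Let int_theta x y : mu.-integrable `[x, y] (EFin \o theta).
Proof. by apply: integrable_segment; exact: continuous_subspaceT. Qed.

Lemma limit_solution_bound t : 0 <= t ->
  `|limit_solution x0 theta t| <= `|x0| * expR (L * t).
Proof.
move=> t0; rewrite /limit_solution normrM ler_wpM2l// gtr0_norm ?expR_gt0//.
rewrite ler_expR; apply: le_trans (ler_norm _) _.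
apply: le_trans (le_normr_Rintegral _ (int_theta _ _)) _ => //.
apply: (@le_trans _ _ (\int[mu]_(s in `[0, t]) L)).
  apply: le_Rintegral => //.
  - exact: integrable_norm (int_theta _ _).
  - by apply: integrable_segment => x; exact: cvg_cst.
rewrite Rintegral_cst//= lebesgue_measure_itv/= lte_fin; case: ifPn => //= _.
  by rewrite subr0.
by rewrite mulr0 mulr_ge0// (le_trans _ (tL 0)).
Qed.

Lemma limit_solution_derive t : 0 < t ->
  is_derive t 1 (limit_solution x0 theta) (theta t * limit_solution x0 theta t).
Proof.
move=> t0; pose F s := \int[mu]_(u in `[0, s]) theta u.
have dF : is_derive t 1 F (theta t).
  have [] := @continuous_FTC1_closed R theta 0 t (t + 1) _ (int_theta _ _) t0 (@tc t).
    by rewrite ltrDl.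
  by move=> dF <-; rewrite derive1E; exact: derivableP.
have dE : is_derive t 1 (expR \o F) (expR (F t) * theta t).
  exact: is_derive1_comp.
have -> : theta t * limit_solution x0 theta t = x0 * (expR (F t) * theta t).
  by rewrite /limit_solution -/(F t); ring.
exact: (is_deriveZ _ dE).
Qed.

Let limit_solution_LR t : 0 < t -> derivable_oo_LRcontinuous (limit_solution x0 theta) 0 t.
Proof.
move=> t0; pose F s := \int[mu]_(u in `[0, s]) theta u.
have /(continuous_within_itvP _ t0)[_ cF0 cFt] :
    {within `[0, t], continuous F} by exact: parameterized_integral_continuous (ltW t0) (int_theta _ _).
have lim (G : set_system R) (FG : Filter G) s : F u @[u --> G] --> F s ->
    limit_solution x0 theta u @[u --> G] --> limit_solution x0 theta s.
  move=> FF; have eF : (expR \o F) u @[u --> G] --> expR (F s).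
    exact: (cvg_comp _ _ FF (@continuous_expR _ _)).
  have x0F : cst x0 u @[u --> G] --> x0 by exact: cvg_cst.
  by have := cvgM x0F eF; exact.
split.
- move=> x; rewrite in_itv/= => /andP[x_gt0 _].
  by apply: ex_derive; exact: limit_solution_derive.
- exact: lim cF0.
- exact: lim cFt.
Qed.

Lemma limit_solution_drift_continuous t : 0 < t ->
  {within `[0, t], continuous (fun s => theta s * limit_solution x0 theta s)}.
Proof.
move=> t0 s; apply: cvgM; first exact: (continuous_subspaceT tc).
exact: (derivable_oo_LRcontinuous_within (limit_solution_LR t0)).
Qed.

Lemma limit_solution_equation t : 0 <= t ->
  limit_solution x0 theta t =
  x0 + \int[mu]_(s in `[0, t]) (theta s * limit_solution x0 theta s).
Proof.
have x00 : limit_solution x0 theta 0 = x0.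
  by rewrite /limit_solution set_itv1 Rintegral_set1 expR0 mulr1.
rewrite le_eqVlt => /predU1P[<-|t0].
  by rewrite set_itv1 Rintegral_set1 addr0.
rewrite /Rintegral (@continuous_FTC2 _ (fun s => theta s * limit_solution x0 theta s)
   (limit_solution x0 theta) 0 t t0 _ (limit_solution_LR t0)).
- by rewrite -EFinB/= x00 addrC subrK.
- exact: limit_solution_drift_continuous.
- move=> s; rewrite in_itv/= => /andP[s0 _].
  by rewrite derive1E; have [_ ->] := limit_solution_derive s0.
Qed.

End LimitSolution.

Section Families.
Variables (m : nat) (L L1 x0 r a b : R).
Hypotheses (L0 : 0 < L) (L10 : 0 < L1) (r0 : 0 < r) (r1 : r <= 1) (ra : r <= a).

Let D : set ((R -> R) * R) := [set i : (R -> R) * R | Theta m L L1 i.1 /\ a <= i.2 <= b].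

(** The bounds on the Taylor coefficients are uniform over the class, although
    only the function itself and the Lipschitz constant of its last derivative
    are bounded: the Taylor polynomial is bounded near the origin, which bounds
    its coefficients. *)
Lemma taylor_family_Theta :
  taylor_family r D m.+1 (fun i h => i.1 (i.2 + h)).
Proof.
have LL : 0 <= L + L1 by rewrite addr_ge0// ltW.
have [C C0 hC] := coef_bound m.+1 r0 LL.
exists (C + L1); first by rewrite addr_ge0// ltW.
move=> [theta t] /= [[tL td tlip] _].
have [p [pm pE]] := taylor_lipschitz t (ltW L10) td tlip.
exists p; split => //.
- move=> j; rewrite (le_trans (hC p pm _ j)) ?lerDl ?(ltW L10)// => h hr.
  have h1 : `|h| <= 1 by rewrite (le_trans (ltW hr)).
  rewrite -[p.[h]](subrK (theta (t + h))) (le_trans (ler_normD _ _))//.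
  rewrite addrC lerD// distrC (le_trans (pE h))// ler_piMr ?(ltW L10)//.
  by rewrite exprn_ile1.
- by move=> h hr; rewrite (le_trans (pE h))// ler_wpM2r ?exprn_ge0// lerDr.
Qed.

(** The limit solution inherits the smoothness of the multiplier through its
    differential equation: each degree gained by the product with the
    multiplier is turned into one more degree by integration. *)
Lemma taylor_family_limit_solution : (0 < m)%N -> forall n, (n <= m.+1)%N ->
  taylor_family r D n (fun i h => limit_solution x0 i.1 (i.2 + h)) /\
  taylor_family r D n (fun i h => i.1 (i.2 + h) * limit_solution x0 i.1 (i.2 + h)).
Proof.
move=> m0.
have Th n : (n <= m.+1)%N -> taylor_family r D n (fun i h => i.1 (i.2 + h)).
  move=> nm; rewrite -(subKn nm); elim: (m.+1 - n)%N => [|j IH].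
    by rewrite subn0; exact: taylor_family_Theta.
  have [jm|mj] := ltnP j m.+1; last first.
    by have -> : (m.+1 - j.+1 = m.+1 - j)%N by lia.
  apply: taylor_familyW => //.
  by have -> : (m.+1 - j.+1).+1 = (m.+1 - j)%N by lia.
have cont i : D i -> continuous i.1.
  case=> -[_ td _] _; apply: derivable1_continuous => x.
  exact: (td 0%N x m0).
pose B := `|x0| * expR (L * (b + 1)).
have B0 : 0 <= B by rewrite mulr_ge0 ?expR_ge0.
have bnd i h : D i -> `|h| < r -> `|limit_solution x0 i.1 (i.2 + h)| <= B.
  move=> Di hr; have ic := cont i Di; case: Di => -[tL _ _] /andP[].
  move: (i.2) => t ai ib.
  have /andP[h1 h2] : - r < h < r by rewrite -ltr_norml.
  have t0 : 0 <= t + h by rewrite -(subrr r) lerD ?(le_trans ra ai)// ltW.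
  have tb : t + h <= b + 1 by rewrite lerD// (le_trans (ltW h2)).
  rewrite (le_trans (limit_solution_bound x0 ic tL t0))//.
  by rewrite ler_wpM2l// ler_expR ler_wpM2l ?(ltW L0).
elim=> [|n IH] nm.
  suff X : taylor_family r D 0 (fun i h => limit_solution x0 i.1 (i.2 + h)).
    by split => //; apply: taylor_familyM => //; exact: Th.
  exact: taylor_family0 B0 bnd.
have [_ IH2] := IH (ltnW nm).
suff X : taylor_family r D n.+1 (fun i h => limit_solution x0 i.1 (i.2 + h)).
  by split => //; apply: taylor_familyM => //; exact: Th.
apply: (taylor_family_deriv (C0 := B)) IH2 => //.
- by move=> i Di; apply: bnd => //; rewrite normr0.
- move=> i h Di hr; apply: is_derive_shift; apply: limit_solution_derive; first exact: cont.
  have /andP[h1 h2] : - r < h < r by rewrite -ltr_norml.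
  by case: Di => _ /andP[]; move: (i.2) => t ai _; rewrite -(subrr r) ler_ltD// (le_trans ra ai).
Qed.

End Families.
End SmoothClass.

(** * Bias of kernel smoothing *)

Section KernelSmoothing.
Context {R : realType}.
Local Notation mu := (@lebesgue_measure R).
Implicit Types (f g : R -> R) (t x y phi : R).

Lemma bounded_integrable_segment x y (B : R) f : measurable_fun `[x, y] f ->
  (forall u, x <= u <= y -> `|f u| <= B) -> mu.-integrable `[x, y] (EFin \o f).
Proof.
move=> mf fB; apply: (@le_integrable _ _ _ mu _ _ _ (EFin \o cst B)) => //.
- exact/measurable_EFinP.
- move=> u; rewrite /= in_itv/= => /fB uB; rewrite lee_fin.
  by rewrite (le_trans uB)// ler_norm.
- by apply: integrable_segment => u; exact: cvg_cst.
Qed.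

Section Affine.
Variables (t phi : R).
Hypothesis phi0 : 0 < phi.

Let psi (u : R) : R := t + phi * u.

Let mpsi : measurable_fun [set: R] psi.
Proof. by apply: measurable_funD => //; exact: measurable_funM. Qed.

Let phi_nng : {nonneg R} := NngNum (ltW phi0).

Let psi_measure : {m : {measure set (measurableTypeR R) -> \bar R} |
  (forall A, m A = phi%:E * mu (psi @^-1` A))%E /\
  (forall f : R -> \bar R, measurable_fun [set: R] f -> (forall x, 0 <= f x)%E ->
    \int[m]_x f x = phi%:E * \int[mu]_u f (psi u))%E}.
Proof.
pose push := (pushforward mu (psi : measurableTypeR R -> measurableTypeR R)
  : {measure set (measurableTypeR R) -> \bar R}).
exists (mscale phi_nng (push mpsi)); split => // f mf f0.
by rewrite ge0_integral_mscale//= ge0_integral_pushforward.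
Qed.

(** Lebesgue measure is [phi] times its image under the affine map, because the
    two measures agree on intervals. *)
Lemma ge0_integral_affine (f : R -> \bar R) : measurable_fun [set: R] f ->
  (forall x, 0 <= f x)%E ->
  (\int[mu]_x f x = phi%:E * \int[mu]_u f (t + phi * u)%R)%E.
Proof.
case: psi_measure => m [mE mI] mf f0; rewrite -(mI f mf f0).
apply: eq_measure_integral => A mA _; apply: lebesgue_measure_unique => //.
move=> _ [[x y] _ <-]; rewrite mE.
have -> : psi @^-1` `]x, y] = `](x - t) / phi, (y - t) / phi]%classic.
  apply/seteqP; split => u /=; rewrite !in_itv/= /psi ltr_pdivrMr// ler_pdivlMr//;
  by rewrite ltrBlDl lerBrDl [u * phi]mulrC.
rewrite !lebesgue_measure_itv/= !lte_fin ltr_pM2r ?invr_gt0// ltrD2r.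
case: ifP => _; last by rewrite mule0.
rewrite -!EFinD -EFinM; congr EFin.
by field; rewrite gt_eqF.
Qed.

Lemma Rintegral_affine (f : R -> R) : measurable_fun [set: R] f ->
  mu.-integrable setT (EFin \o f) ->
  \int[mu]_x f x = phi * \int[mu]_u f (t + phi * u).
Proof.
move=> mf fi; have mE : measurable_fun [set: R] (EFin \o f) by exact/measurable_EFinP.
have mp := measurable_funepos mE; have mn := measurable_funeneg mE.
have hp := ge0_integral_affine mp (fun x => funepos_ge0 _ x).
have hn := ge0_integral_affine mn (fun x => funeneg_ge0 _ x).
have pfin : (\int[mu]_x (EFin \o f)^\+ x)%E \is a fin_num.
  by apply: integrable_fin_num => //; exact: integrable_funepos.
have nfin : (\int[mu]_x (EFin \o f)^\- x)%E \is a fin_num.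
  by apply: integrable_fin_num => //; exact: integrable_funeneg.
have fin (z : \bar R) : (0 <= z)%E -> (phi%:E * z)%E \is a fin_num -> z \is a fin_num.
  by case: z => // _; rewrite gt0_muley ?lte_fin.
have pfin' : (\int[mu]_u (EFin \o f)^\+ (t + phi * u)%R)%E \is a fin_num.
  by apply: fin; [exact: integral_ge0|rewrite -hp].
have nfin' : (\int[mu]_u (EFin \o f)^\- (t + phi * u)%R)%E \is a fin_num.
  by apply: fin; [exact: integral_ge0|rewrite -hn].
have -> : \int[mu]_u f (t + phi * u) =
  fine (\int[mu]_u (EFin \o f)^\+ (t + phi * u)%R - \int[mu]_u (EFin \o f)^\- (t + phi * u)%R)%E.
  rewrite /Rintegral integralE.
  by congr (fine (_ - _)%E); apply: eq_integral => u _; rewrite ?funeposE ?funenegE.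
by rewrite /Rintegral integralE hp hn -(fineK pfin') -(fineK nfin') /= -mulrBr.
Qed.

End Affine.

Variables (G : R -> R) (M A B : R) (k : nat).
Hypotheses (mG : measurable_fun [set: R] G) (GM : forall u, `|G u| <= M).
Hypotheses (A0 : A < 0) (B0 : 0 < B) (G0 : forall u, ~ (A <= u <= B) -> G u = 0).
Hypothesis G1 : \int[mu]_(u in `[A, B]) G u = 1.
Hypothesis Gj : forall j : nat, (1 <= j <= k)%N -> \int[mu]_u (u ^+ j * G u) = 0.

Let M0 : 0 <= M. Proof. exact: le_trans (GM 0). Qed.

Lemma support_norm u : A <= u <= B -> `|u| <= B - A.
Proof. by move=> /andP[Au uB]; rewrite ler_norml; move: A0 B0 Au uB; lra. Qed.

Let int_mom j : mu.-integrable `[A, B] (EFin \o (fun u => u ^+ j * G u)).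
Proof.
apply: (@bounded_integrable_segment _ _ ((B - A) ^+ j * M)).
  apply: measurable_funTS; apply: measurable_funM => //; exact: measurable_funX.
move=> u /support_norm uAB; rewrite normrM normrX ler_pM ?exprn_ge0//.
by rewrite lerXn2r ?nnegrE// (le_trans _ uAB).
Qed.

Lemma kernel_moment j : (j <= k)%N ->
  \int[mu]_(u in `[A, B]) (u ^+ j * G u) = (j == 0)%:R.
Proof.
case: j => [|j] jk.
  by rewrite -G1; apply: eq_Rintegral => u _; rewrite expr0 mul1r.
transitivity (\int[mu]_u (u ^+ j.+1 * G u)); last exact: Gj.
rewrite Rintegral_mkcond; apply: eq_Rintegral => u _.
rewrite patchE; case: ifPn => //; rewrite notin_setE/= in_itv/= => /G0 ->.
by rewrite mulr0.
Qed.

Lemma kernel_reproduces (p : {poly R}) phi : (size p <= k.+1)%N ->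
  mu.-integrable `[A, B] (EFin \o (fun u => G u * p.[phi * u])) /\
  \int[mu]_(u in `[A, B]) (G u * p.[phi * u]) = p.[0].
Proof.
move=> pk.
have main n : (n <= k.+1)%N ->
  mu.-integrable `[A, B] (EFin \o (fun u => \sum_(j < n) (p`_j * phi ^+ j) * (u ^+ j * G u))) /\
  \int[mu]_(u in `[A, B]) (\sum_(j < n) (p`_j * phi ^+ j) * (u ^+ j * G u)) =
  \sum_(j < n) (p`_j * phi ^+ j) * (j == 0%N :> nat)%:R.
  elim: n => [|n IH] nk.
    have -> : (fun u : R => \sum_(j < 0) (p`_j * phi ^+ j) * (u ^+ j * G u)) = cst 0.
      by apply/funext => u; rewrite big_ord0.
    split; first by apply: integrable_segment => u; exact: cvg_cst.
    by rewrite big_ord0 Rintegral_cst// mul0r.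
  have [In En] := IH (ltnW nk).
  have Iz : mu.-integrable `[A, B] (EFin \o (fun u => p`_n * phi ^+ n * (u ^+ n * G u))).
    exact: (integrableZl _ (p`_n * phi ^+ n) (int_mom n)).
  have eq_rec : (fun u => \sum_(j < n.+1) (p`_j * phi ^+ j) * (u ^+ j * G u)) =
    (fun u => \sum_(j < n) (p`_j * phi ^+ j) * (u ^+ j * G u) +
       p`_n * phi ^+ n * (u ^+ n * G u)) by apply/funext => u; rewrite big_ord_recr.
  rewrite eq_rec; split.
    exact: (integrableD _ In Iz).
  rewrite RintegralD// En (RintegralZl _ _ (int_mom n))//.
  by rewrite kernel_moment// big_ord_recr.
have [I1 E1] := main k.+1 (leqnn _).
have eqf : (fun u => G u * p.[phi * u]) =
    (fun u => \sum_(j < k.+1) (p`_j * phi ^+ j) * (u ^+ j * G u)).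
  apply/funext => u; rewrite (horner_coef_wide _ pk) mulr_sumr.
  by apply: eq_bigr => j _; rewrite exprMn; ring.
rewrite eqf; split => //; rewrite E1 big_ord_recl/= expr0 !mulr1 big1 ?addr0 ?horner_coef0//.
by move=> j _; rewrite mulr0.
Qed.

(** The kernel reproduces polynomials of degree at most [k], so only the Taylor
    remainder contributes to the bias. *)
Lemma kernel_bias (F : R -> R) (p : {poly R}) (C BF T t phi r : R) :
  0 < phi -> phi * (B - A) < r -> 0 <= t + phi * A -> t + phi * B <= T ->
  measurable_fun `[0, T] F -> (forall u, 0 <= u <= T -> `|F u| <= BF) ->
  (size p <= k.+1)%N -> 0 <= C ->
  (forall h, `|h| < r -> `|F (t + h) - p.[h]| <= C * `|h| ^+ k.+1) ->
  `|phi^-1 * \int[mu]_(u in `[0, T]) (G ((u - t) / phi) * F u) - F t| <=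
     M * C * (B - A) ^+ k.+2 * phi ^+ k.+1.
Proof.
move=> phi0 phir tA tB mF FB pk C0 Fp.
have BA0 : 0 < B - A by rewrite subr_gt0 (lt_trans A0).
have r0 : 0 < r by rewrite (lt_trans _ phir)// mulr_gt0.
have inT u : A <= u <= B -> 0 <= t + phi * u <= T.
  move=> /andP[Au uB]; apply/andP; split.
    by rewrite (le_trans tA)// lerD2l ler_pM2l.
  by rewrite (le_trans _ tB)// lerD2l ler_pM2l.
have hr u : A <= u <= B -> `|phi * u| < r.
  move=> /support_norm uBA; rewrite normrM gtr0_norm// (le_lt_trans _ phir)//.
  by rewrite ler_pM2l.
have BF0 : 0 <= BF.
  by apply: le_trans (FB (t + phi * 0) _) => //; apply: inT; rewrite !ltW.
pose F' : R -> R := F \_ `[0, T].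
have mF' : measurable_fun [set: R] F'.
  exact: (proj1 (measurable_restrictT F (measurable_itv `[0, T])) mF).
have F'B u : `|F' u| <= BF.
  rewrite /F' patchE; case: ifPn => [|_]; last by rewrite normr0.
  by rewrite inE/= in_itv/= => /FB.
have mG' : measurable_fun [set: R] (fun u => G ((u - t) / phi)).
  apply: measurableT_comp => //; apply: measurable_funM => //.
  exact: measurable_funB.
pose f u := G ((u - t) / phi) * F' u.
have mf : measurable_fun [set: R] f by exact: measurable_funM.
have fE : \int[mu]_(u in `[0, T]) (G ((u - t) / phi) * F u) = \int[mu]_u f u.
  rewrite Rintegral_mkcond; apply: eq_Rintegral => u _.
  by rewrite /f /F' !patchE; case: ifP; rewrite ?mulr0.
have fi : mu.-integrable setT (EFin \o f).
  have -> : EFin \o f = ((EFin \o f) \_ `[0, T]).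
    apply/funext => u; rewrite patchE; case: ifPn => //.
    by move=> uT; rewrite /= /f /F' patchE (negbTE uT) mulr0.
  apply/integrable_restrict => //; rewrite setTI.
  apply: (@bounded_integrable_segment _ _ (M * BF)); first exact: measurable_funTS.
  by move=> u _; rewrite normrM ler_pM.
have fpsi u : f (t + phi * u) = G u * F' (t + phi * u).
  rewrite /f (_ : (t + phi * u - t) / phi = u)//.
  by field; rewrite gt_eqF.
have IGF : mu.-integrable `[A, B] (EFin \o (fun u => G u * F (t + phi * u))).
  apply: (@bounded_integrable_segment _ _ (M * BF)).
    apply: (@eq_measurable_fun _ _ _ _ _ (fun u => G u * F' (t + phi * u))).
      move=> u; rewrite inE/= in_itv/= => /inT uT.
      by rewrite /F' patchE mem_set//= in_itv.
    apply: measurable_funTS; apply: measurable_funM => //.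
    apply: measurableT_comp => //; apply: measurable_funD => //.
  by move=> u /inT uT; rewrite normrM ler_pM// FB.
have -> : phi^-1 * \int[mu]_(u in `[0, T]) (G ((u - t) / phi) * F u) =
    \int[mu]_(u in `[A, B]) (G u * F (t + phi * u)).
  rewrite fE (Rintegral_affine t phi0 mf fi) mulrA mulVf ?gt_eqF// mul1r.
  rewrite [RHS]Rintegral_mkcond; apply: eq_Rintegral => u _; rewrite fpsi patchE.
  case: ifPn; last by rewrite notin_setE/= in_itv/= => /G0 ->; rewrite mul0r.
  rewrite inE/= in_itv/= => /inT uT.
  by rewrite /F' patchE mem_set//= in_itv.
have [Ip Ep] := kernel_reproduces phi pk.
have Ft : F t = p.[0].
  have := Fp 0; rewrite normr0 => /(_ r0); rewrite expr0n/= mulr0 addr0 normr_le0.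
  by rewrite subr_eq0 => /eqP.
rewrite Ft -Ep -RintegralB//.
have ID : mu.-integrable `[A, B] (EFin \o (fun u => G u * F (t + phi * u) - G u * p.[phi * u])).
  exact: (integrableB _ IGF Ip).
rewrite (le_trans (le_normr_Rintegral _ ID))//.
apply: (@le_trans _ _ (\int[mu]_(u in `[A, B]) (M * C * (B - A) ^+ k.+1 * phi ^+ k.+1))).
  apply: le_Rintegral => //.
  - exact: integrable_norm ID.
  - by apply: integrable_segment => u; exact: cvg_cst.
  - move=> u; rewrite /= in_itv/= => uAB.
    rewrite -mulrBr normrM -!mulrA; apply: ler_pM => //.
    rewrite (le_trans (Fp _ (hr _ uAB)))// ler_wpM2l// normrM gtr0_norm// exprMn mulrC.
    by rewrite ler_wpM2r ?exprn_ge0 ?(ltW phi0)// lerXn2r ?nnegrE ?(ltW BA0)// support_norm.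
rewrite Rintegral_cst//= lebesgue_measure_itv/= lte_fin (lt_trans A0)//= le_eqVlt.
by apply/orP; left; apply/eqP; rewrite [in RHS]exprSr; ring.
Qed.

End KernelSmoothing.

(** * Pathwise bounds for the state error *)

Section Paths.
Context {R : realType}.
Local Notation mu := (@lebesgue_measure R).
Implicit Types (z u g : R -> R) (x y s t T L M : R).

Lemma integrable_sub_segment f (x y x' y' : R) : x <= x' -> y' <= y ->
  mu.-integrable `[x, y] (EFin \o f) -> mu.-integrable `[x', y'] (EFin \o f).
Proof.
move=> xx yy; apply: integrableS => //.
by apply: subset_itv; rewrite bnd_simp.
Qed.

Lemma Rintegral_segment_cst (c x y : R) : x <= y ->
  \int[mu]_(_ in `[x, y]) c = c * (y - x).
Proof.
move=> xy; rewrite Rintegral_cst//= lebesgue_measure_itv/= lte_fin.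
case: ltP => [//|yx]; have -> : y = x by apply/eqP; rewrite eq_le xy yx.
by rewrite subrr.
Qed.

Lemma le_Rintegral_segment f (x y x' y' : R) : x <= x' -> y' <= y ->
  mu.-integrable `[x, y] (EFin \o f) -> (forall t, x <= t <= y -> 0 <= f t) ->
  \int[mu]_(t in `[x', y']) f t <= \int[mu]_(t in `[x, y]) f t.
Proof.
move=> xx yy fi f0; rewrite /Rintegral.
have fi' := integrable_sub_segment xx yy fi.
rewrite fine_le ?integrable_fin_num//.
apply: ge0_subset_integral.
- exact: measurable_itv.
- exact: measurable_itv.
- by case/integrableP: fi.
- by move=> t /=; rewrite in_itv/= => /f0 ft; rewrite lee_fin.
- by apply: subset_itv; rewrite bnd_simp.
Qed.

Lemma cauchy_schwarz_segment u (x y : R) : x < y ->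
  mu.-integrable `[x, y] (EFin \o u) ->
  mu.-integrable `[x, y] (EFin \o (fun t => u t ^+ 2)) ->
  (\int[mu]_(t in `[x, y]) u t) ^+ 2 <= (y - x) * \int[mu]_(t in `[x, y]) u t ^+ 2.
Proof.
move=> xy iu iu2; set I := \int[mu]_(t in `[x, y]) u t.
pose m := I / (y - x).
have yx0 : 0 < y - x by rewrite subr_gt0.
have : 0 <= \int[mu]_(t in `[x, y]) (u t - m) ^+ 2.
  by apply: Rintegral_ge0 => t _; rewrite sqr_ge0.
have im : mu.-integrable `[x, y] (EFin \o (fun t => 2 * m * u t)).
  exact: (integrableZl _ (2 * m) iu).
have ic : mu.-integrable `[x, y] (EFin \o (fun _ : R => m ^+ 2)).
  by apply: integrable_segment => t; exact: cvg_cst.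
have ib : mu.-integrable `[x, y] (EFin \o (fun t => u t ^+ 2 - 2 * m * u t)).
  exact: (integrableB _ iu2 im).
have -> : \int[mu]_(t in `[x, y]) (u t - m) ^+ 2 =
  \int[mu]_(t in `[x, y]) (u t ^+ 2 - 2 * m * u t + m ^+ 2).
  by apply: eq_Rintegral => t _; ring.
rewrite RintegralD// RintegralB// (RintegralZl _ _ iu)// Rintegral_segment_cst ?(ltW xy)// -/I.
move=> h; have := mulr_ge0 (ltW yx0) h.
have -> : (y - x) * (\int[mu]_(t in `[x, y]) u t ^+ 2 - 2 * m * I + m ^+ 2 * (y - x)) =
  (y - x) * \int[mu]_(t in `[x, y]) u t ^+ 2 - I ^+ 2.
  by rewrite /m; field; rewrite gt_eqF.
by rewrite subr_ge0.
Qed.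

(** On a time step of length at most [1 / (2 * L)] the integral inequality
    bounds the increment of the integral of [|z|] by half of that integral plus
    the integral of [u]; finitely many steps cover [0, T]. Only integrals of [u]
    occur, because the noise is controlled in quadratic mean and not uniformly
    in time. *)
Lemma gronwall_integral T L : 0 < T -> 0 < L -> exists2 C : R, 0 <= C &
  forall z u, mu.-integrable `[0, T] (EFin \o z) -> mu.-integrable `[0, T] (EFin \o u) ->
  (forall t, 0 <= t <= T -> 0 <= u t) ->
  (forall t, 0 <= t <= T -> `|z t| <= L * \int[mu]_(s in `[0, t]) `|z s| + u t) ->
  \int[mu]_(s in `[0, T]) `|z s| <= C * \int[mu]_(s in `[0, T]) u s.
Proof.
move=> T0 L0; pose n := (Num.bound (2 * L * T)).+1.
have nLT : 2 * L * T <= n%:R.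
  rewrite ltW// (lt_trans (archi_boundP _)) ?ltr_nat//.
  by rewrite !mulr_ge0 ?(ltW L0) ?(ltW T0).
have n0 : 0 < n%:R :> R by rewrite ltr0n.
exists (2 ^+ n.+1); first by rewrite exprn_ge0.
move=> z u iz iu u0 zu; pose v t := \int[mu]_(s in `[0, t]) `|z s|.
set U := \int[mu]_(s in `[0, T]) u s.
have U0 : 0 <= U by apply: Rintegral_ge0 => t; rewrite /= in_itv/=; exact: u0.
have inz : mu.-integrable `[0, T] (EFin \o (fun s => `|z s|)) by exact: integrable_norm iz.
have step s t : 0 <= s -> s <= t -> t <= T -> (t - s) * L <= 2^-1 -> v t <= 2 * v s + 2 * U.
  move=> s0 st tT stL.
  have t0 : 0 <= t by exact: le_trans st.
  have vt0 : 0 <= v t by apply: Rintegral_ge0.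
  have izt : mu.-integrable `[0, t] (EFin \o (fun s => `|z s|)).
    exact: integrable_sub_segment inz.
  have sub : `]s, t] `<=` `[0, T].
    move=> r /=; rewrite !in_itv/= => /andP[sr rt]; rewrite (le_trans s0 (ltW sr))/=.
    exact: le_trans tT.
  have sub' : `]s, t] `<=` `[s, t] by move=> r /=; rewrite !in_itv/= => /andP[/ltW-> ->].
  have E : v t - v s = \int[mu]_(r in `]s, t]) `|z r|.
    by rewrite /v; apply: Rintegral_itvB => //; rewrite bnd_simp.
  have icst : mu.-integrable `]s, t] (EFin \o (fun _ : R => L * v t)).
    apply: (@integrableS _ _ _ mu `[s, t]%classic) => //.
    by apply: integrable_segment => r; exact: cvg_cst.
  have iust : mu.-integrable `]s, t] (EFin \o u) by apply: (@integrableS _ _ _ mu `[0, T]%classic).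
  have B : \int[mu]_(r in `]s, t]) `|z r| <= \int[mu]_(r in `]s, t]) (L * v t + u r).
    apply: le_Rintegral => //.
    - by apply: (@integrableS _ _ _ mu `[0, T]%classic).
    - exact: (integrableD _ icst iust).
    - move=> r rst; have := sub r rst; rewrite /= in_itv/= => rT.
      rewrite (le_trans (zu r rT))// lerD2r ler_wpM2l ?(ltW L0)//.
      apply: le_Rintegral_segment => //; move: rst; rewrite /= in_itv/= => /andP[//].
  rewrite RintegralD// in B.
  have C1 : \int[mu]_(r in `]s, t]) (L * v t) = L * v t * (t - s).
    rewrite Rintegral_cst//= lebesgue_measure_itv/= lte_fin.
    case: ltP => [//|ts]; have -> : t = s by apply/eqP; rewrite eq_le st ts.
    by rewrite subrr.
  have C2 : \int[mu]_(r in `]s, t]) u r <= U.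
    rewrite /U /Rintegral fine_le ?integrable_fin_num//.
    apply: ge0_subset_integral.
    - exact: measurable_itv.
    - exact: measurable_itv.
    - by case/integrableP: iu.
    - by move=> r /=; rewrite in_itv/= => /u0 ur; rewrite lee_fin.
    - exact: sub.
  have : L * v t * (t - s) <= 2^-1 * v t.
    rewrite (_ : L * v t * (t - s) = (t - s) * L * v t); last by ring.
    by rewrite ler_wpM2r.
  by move: B; rewrite C1 -E; move: (v t) (v s) (\int[mu]_(r in _) _) C2 => ? ? ? ?; lra.
pose s i := T * i%:R / n%:R.
have main i : (i <= n)%N -> v (s i) <= (2 ^+ i.+1 - 2) * U.
  elim: i => [|i IH] ni.
    by rewrite /s mulr0 mul0r /v set_itv1 Rintegral_set1 expr1 subrr mul0r.
  apply: (le_trans (step (s i) (s i.+1) _ _ _ _)).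
  - by rewrite divr_ge0 ?mulr_ge0 ?(ltW T0).
  - by rewrite ler_wpM2r ?invr_ge0// ler_wpM2l ?(ltW T0)// ler_nat.
  - by rewrite ler_pdivrMr// ler_pM2l// ler_nat.
  - have -> : (s i.+1 - s i) * L = L * T / n%:R.
      by rewrite /s -natr1; field; rewrite gt_eqF.
    by rewrite ler_pdivrMr//; move: nLT; lra.
  - have := IH (ltnW ni); rewrite (exprS 2 i.+1).
    by move: (v _) (2 ^+ i.+1) => a b ab; lra.
have -> : T = s n by rewrite /s mulfK// gt_eqF.
rewrite (le_trans (main n _))// ler_wpM2r// gerBl//.
Qed.

(** The error of the state enters the estimator through its integral against
    the kernel, so only an integral over the window and one over the whole time
    interval are needed, never a pointwise supremum. *)
Lemma window_integral_sqr_le T L : 0 < T -> 0 < L -> exists2 C : R, 0 <= C &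
  forall z u g (alpha beta M : R),
  0 <= alpha -> alpha < beta -> beta <= T ->
  mu.-integrable `[0, T] (EFin \o z) ->
  measurable_fun `[0, T] u -> (forall t, 0 <= t <= T -> 0 <= u t) ->
  mu.-integrable `[0, T] (EFin \o (fun t => u t ^+ 2)) ->
  (forall t, 0 <= t <= T -> `|z t| <= L * \int[mu]_(s in `[0, t]) `|z s| + u t) ->
  measurable_fun [set: R] g -> (forall t, `|g t| <= M) ->
  (forall t, ~ (alpha <= t <= beta) -> g t = 0) ->
  (\int[mu]_(t in `[0, T]) (g t * z t)) ^+ 2 <=
  C * M ^+ 2 * ((beta - alpha) ^+ 2 * \int[mu]_(t in `[0, T]) u t ^+ 2 +
                (beta - alpha) * \int[mu]_(t in `[alpha, beta]) u t ^+ 2).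
Proof.
move=> T0 L0; have [C C0 hC] := gronwall_integral T0 L0.
have C20 : 0 <= 2 * (L * C) ^+ 2 * T.
  by apply: mulr_ge0; [apply: mulr_ge0 => //; exact: sqr_ge0|exact: ltW].
exists (2 * (L * C) ^+ 2 * T + 2); first by rewrite addr_ge0.
move=> z u g al be M al0 ab bT iz mu_u u0 iu2 zu mg gM g0.
have M0 : 0 <= M by exact: le_trans (gM 0).
have iu : mu.-integrable `[0, T] (EFin \o u).
  apply: (@le_integrable _ _ _ mu _ _ _ (EFin \o (fun t => 1 + u t ^+ 2))) => //.
  - exact/measurable_EFinP.
  - move=> t _ /=; rewrite lee_fin [leRHS]ger0_norm ?addr_ge0 ?sqr_ge0//.
    rewrite -(real_normK (num_real (u t))).
    have : 0 <= (`|u t| - 1) ^+ 2 by rewrite sqr_ge0.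
    have : 0 <= `|u t| by [].
    by move: `|u t| => a a0; rewrite sqrrB1 => h; nra.
  - have ic : mu.-integrable `[0, T] (EFin \o (fun _ : R => 1)).
      by apply: integrable_segment => t; exact: cvg_cst.
    exact: (integrableD _ ic iu2).
have inz : mu.-integrable `[0, T] (EFin \o (fun s => `|z s|)) by exact: integrable_norm iz.
have inzw := integrable_sub_segment al0 bT inz.
have iuw := integrable_sub_segment al0 bT iu.
have iu2w := integrable_sub_segment al0 bT iu2.
set V := \int[mu]_(s in `[0, T]) `|z s|.
have V0 : 0 <= V by apply: Rintegral_ge0.
have VU := hC z u iz iu u0 zu; rewrite -/V in VU.
have gz_eq : \int[mu]_(t in `[0, T]) (g t * z t) = \int[mu]_(t in `[al, be]) (g t * z t).
  rewrite Rintegral_mkcond [RHS]Rintegral_mkcond; apply: eq_Rintegral => t _.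
  rewrite !patchE; case: ifPn => [tT|tT]; case: ifPn => [tw|tw] //.
    by move: tw; rewrite notin_setE/= in_itv/= => /g0 ->; rewrite mul0r.
  move: tT tw; rewrite notin_setE inE/= !in_itv/= => tT /andP[at1 tb]; exfalso; apply: tT.
  by rewrite (le_trans al0)//= (le_trans tb).
have igz : mu.-integrable `[al, be] (EFin \o (fun t => g t * z t)).
  apply: (@le_integrable _ _ _ mu _ _ _ (EFin \o (fun t => M * `|z t|))) => //.
  - apply/measurable_EFinP; apply: measurable_funM; first exact: measurable_funTS.
    have := integrable_sub_segment al0 bT iz.
    by case/integrableP => /measurable_EFinP.
  - move=> t _ /=; rewrite lee_fin normrM [leRHS]ger0_norm ?mulr_ge0//.
    by rewrite ler_wpM2r.
  - exact: (integrableZl _ M inzw).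
have W1 : `|\int[mu]_(t in `[al, be]) (g t * z t)| <=
    M * (L * V * (be - al) + \int[mu]_(t in `[al, be]) u t).
  apply: (le_trans (le_normr_Rintegral _ igz)) => //.
  have ic : mu.-integrable `[al, be] (EFin \o (fun _ : R => L * V)).
    by apply: integrable_segment => t; exact: cvg_cst.
  have icu : mu.-integrable `[al, be] (EFin \o (fun t => L * V + u t)).
    exact: (integrableD _ ic iuw).
  apply: (@le_trans _ _ (\int[mu]_(t in `[al, be]) (M * (L * V + u t)))).
    apply: le_Rintegral => //.
    - exact: integrable_norm igz.
    - exact: (integrableZl _ M icu).
    - move=> t; rewrite /= in_itv/= => /andP[at1 tb].
      have t0 : 0 <= t by exact: le_trans at1.
      have tT : t <= T by exact: le_trans bT.
      rewrite normrM ler_pM// (le_trans (zu t _)) ?t0// lerD2r ler_wpM2l ?(ltW L0)//.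
      exact: le_Rintegral_segment.
  by rewrite (RintegralZl _ _ icu)// RintegralD// Rintegral_segment_cst// ltW.
rewrite gz_eq -(real_normK (num_real (\int[mu]_(t in `[al, be]) _))).
set S := \int[mu]_(t in `[0, T]) u t ^+ 2.
set Sw := \int[mu]_(t in `[al, be]) u t ^+ 2.
have S0 : 0 <= S by apply: Rintegral_ge0 => t _; rewrite sqr_ge0.
have Sw0 : 0 <= Sw by apply: Rintegral_ge0 => t _; rewrite sqr_ge0.
have cs1 : (\int[mu]_(t in `[0, T]) u t) ^+ 2 <= T * S.
  by have := cauchy_schwarz_segment T0 iu iu2; rewrite subr0.
have cs2 := cauchy_schwarz_segment ab iuw iu2w; rewrite -/Sw in cs2.
have w0 : 0 < be - al by rewrite subr_gt0.
have Uw0 : 0 <= \int[mu]_(t in `[al, be]) u t.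
  apply: Rintegral_ge0 => t; rewrite /= in_itv/= => /andP[at1 tb]; apply: u0.
  by rewrite (le_trans al0)//= (le_trans tb).
set Uw := \int[mu]_(t in `[al, be]) u t in W1 cs2 Uw0.
set U := \int[mu]_(t in `[0, T]) u t in VU cs1.
set w := be - al in W1 cs2 w0 *.
have V2 : (L * V) ^+ 2 <= (L * C) ^+ 2 * T * S.
  apply: (@le_trans _ _ ((L * (C * U)) ^+ 2)).
    have CU0 := le_trans V0 VU.
    apply: lerXn2r; rewrite ?nnegrE; last exact: (ler_wpM2l (ltW L0) VU).
      exact: mulr_ge0 (ltW L0) V0.
    exact: mulr_ge0 (ltW L0) CU0.
  have -> : (L * (C * U)) ^+ 2 = (L * C) ^+ 2 * U ^+ 2 by ring.
  by rewrite -mulrA ler_wpM2l// sqr_ge0.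
apply: (@le_trans _ _ ((M * (L * V * w + Uw)) ^+ 2)).
  by rewrite lerXn2r ?nnegrE// (le_trans _ W1).
rewrite exprMn [leRHS](_ : _ = M ^+ 2 * ((2 * (L * C) ^+ 2 * T + 2) * (w ^+ 2 * S + w * Sw))); last first.
  by ring.
rewrite ler_wpM2l ?sqr_ge0//.
have q : 0 <= (L * V * w - Uw) ^+ 2 by rewrite sqr_ge0.
apply: (@le_trans _ _ (2 * ((L * V) ^+ 2 * w ^+ 2) + 2 * Uw ^+ 2)).
  have -> : (L * V * w + Uw) ^+ 2 = 2 * ((L * V) ^+ 2 * w ^+ 2) + 2 * Uw ^+ 2 - (L * V * w - Uw) ^+ 2.
    by ring.
  by rewrite gerBl.
have r1 : (L * V) ^+ 2 * w ^+ 2 <= (L * C) ^+ 2 * T * S * w ^+ 2.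
  by rewrite ler_wpM2r ?sqr_ge0.
have p1 : 0 <= 2 * (w ^+ 2 * S).
  by apply: mulr_ge0 => //; apply: mulr_ge0 => //; exact: sqr_ge0.
have p2 : 0 <= 2 * (L * C) ^+ 2 * T * (w * Sw) by rewrite mulr_ge0// mulr_ge0 ?(ltW w0).
have -> : (2 * (L * C) ^+ 2 * T + 2) * (w ^+ 2 * S + w * Sw) =
  2 * ((L * C) ^+ 2 * T * S * w ^+ 2) + 2 * (w * Sw) +
   (2 * (w ^+ 2 * S) + 2 * (L * C) ^+ 2 * T * (w * Sw)) by ring.
apply: (@le_trans _ _ (2 * ((L * C) ^+ 2 * T * S * w ^+ 2) + 2 * (w * Sw))).
  by rewrite lerD// ler_wpM2l.
by rewrite lerDl addr_ge0.
Qed.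

End Paths.

(** * Energy of the noise *)

Section NoiseField.
Context {R : realType} {d : measure_display} {Omega : measurableType d}.
Variables (P : probability Omega R) (H K T : R) (W : R -> {RV P >-> R}).
Local Notation mu := (@lebesgue_measure R).
Hypotheses (H1 : 0 < H < 1) (K1 : 0 < K <= 1) (HK1 : 2^-1 < H * K < 1) (T0 : 0 < T).
Hypothesis BW : bifractional_brownian_motion H K W.

(** Joint measurability in time and chance, which Tonelli's theorem requires of
    the noise, is inherited from the state: the equation writes the noise as the
    state minus a time integral of the state. *)
Lemma noise_field (x0 eps : R) (theta : R -> R) (X : R -> Omega -> R) :
  measurable_fun [set: R] theta -> is_solution T W x0 eps theta X ->
  exists2 U : R * Omega -> R, measurable_fun setT U &
    {ae P, forall w, forall t, 0 <= t <= T -> U (t, w) = eps * W t w}.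
Proof.
move=> mth [mX sol].
pose Xm : R * Omega -> R := (fun p => X p.1 p.2) \_ (`[0, T] `*` [set: Omega]).
have mXm : measurable_fun setT Xm.
  apply: (proj1 (measurable_restrictT (fun p : R * Omega => X p.1 p.2) _) mX).
  by apply: measurableX; [exact: measurable_itv|exact: measurableT].
have XmE t w : 0 <= t <= T -> Xm (t, w) = X t w.
  by move=> tT; rewrite /Xm patchE mem_set//=; split => //=; rewrite in_itv.
pose f (q : (R * Omega) * R) : \bar R :=
  (if (0 <= q.2) && (q.2 <= q.1.1) then theta q.2 * Xm (q.2, q.1.2) else 0)%:E.
have mf : measurable_fun setT f.
  have m2 : measurable_fun [set: (R * Omega) * R] snd by exact: measurable_snd.
  have m1 : measurable_fun [set: (R * Omega) * R] fst by exact: measurable_fst.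
  have m11 : measurable_fun [set: (R * Omega) * R] (fun q => q.1.1).
    by apply: (measurableT_comp _ m1); exact: measurable_fst.
  have m12 : measurable_fun [set: (R * Omega) * R] (fun q => q.1.2).
    by apply: (measurableT_comp _ m1); exact: measurable_snd.
  apply/measurable_EFinP; apply: measurable_fun_ifT.
  - by apply: measurable_and; apply: measurable_fun_ler => //; exact: measurable_cst.
  - apply: measurable_funM; first exact: measurableT_comp.
    by apply: (measurableT_comp mXm); exact: measurable_fun_pair.
  - exact: measurable_cst.
pose Ip (p : R * Omega) := (\int[mu]_s f^\+ (p, s))%E.
pose In (p : R * Omega) := (\int[mu]_s f^\- (p, s))%E.
have mIp : measurable_fun setT Ip.
  apply: (@measurable_fun_fubini_tonelli_F _ _ _ _ R mu f^\+%E).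
    exact: measurable_funepos.
  by move=> q; exact: funepos_ge0.
have mIn : measurable_fun setT In.
  apply: (@measurable_fun_fubini_tonelli_F _ _ _ _ R mu f^\-%E).
    exact: measurable_funeneg.
  by move=> q; exact: funeneg_ge0.
exists (fun p => Xm p - x0 - (fine (Ip p) - fine (In p))).
  apply: measurable_funB; first exact: measurable_funB.
  by apply: measurable_funB; apply: measurableT_comp.
apply: filterS sol => w [iX eqX] t tT; rewrite XmE// eqX//.
suff -> : \int[mu]_(s in `[0, t]) (theta s * X s w) = fine (Ip (t, w)) - fine (In (t, w)).
  by ring.
case/andP: tT => t0 tT.
have iXt : mu.-integrable `[0, t] (fun s => (theta s * X s w)%:E).
  exact: (integrable_sub_segment (f := fun s => theta s * X s w) (lexx 0) tT iX).
have fE : (fun s => f ((t, w), s)) = ((fun s => (theta s * X s w)%:E) \_ `[0, t]).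
  apply/funext => s; rewrite /f patchE /=.
  case: ifPn => [st|st].
    by rewrite mem_set/= ?in_itv//= XmE//; case/andP: st => -> /le_trans ->.
  by rewrite memNset//= in_itv/=; apply/negP.
have fpE : (fun s => f^\+ ((t, w), s))%E = (fun s => f ((t, w), s))^\+%E.
  by apply/funext => s; rewrite !funeposE.
have fnE : (fun s => f^\- ((t, w), s))%E = (fun s => f ((t, w), s))^\-%E.
  by apply/funext => s; rewrite !funenegE.
have ift : mu.-integrable setT (fun s => f ((t, w), s)).
  by rewrite fE; apply/integrable_restrict => //; rewrite setTI.
rewrite /Rintegral integral_mkcond -fE integralE -fpE -fnE fineB//.
- by rewrite /Ip fpE; apply: integrable_fin_num => //; exact: integrable_funepos.
- by rewrite /In fnE; apply: integrable_fin_num => //; exact: integrable_funeneg.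
Qed.

Variables (eps : R) (U : R * Omega -> R).
Hypothesis mU : measurable_fun setT U.
Hypothesis UW : {ae P, forall w, forall t, 0 <= t <= T -> U (t, w) = eps * W t w}.

Definition noise_energy (alpha beta : R) (w : Omega) : \bar R :=
  (\int[mu]_(t in `[alpha, beta]) (U (t, w) ^+ 2)%:E)%E.

Lemma noise_energy_ge0 alpha beta w : (0 <= noise_energy alpha beta w)%E.
Proof. by apply: integral_ge0 => t _; rewrite lee_fin sqr_ge0. Qed.

Let cut alpha beta (p : R * Omega) : \bar R :=
  (if (alpha <= p.1) && (p.1 <= beta) then U p ^+ 2 else 0)%:E.

Let mcut alpha beta : measurable_fun setT (cut alpha beta).
Proof.
apply/measurable_EFinP; apply: measurable_fun_ifT.
- apply: measurable_and; apply: measurable_fun_ler => //;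
    try exact: measurable_cst; exact: measurable_fst.
- exact: measurable_funX.
- exact: measurable_cst.
Qed.

Let cut_ge0 alpha beta p : (0 <= cut alpha beta p)%E.
Proof. by rewrite /cut lee_fin; case: ifP => // _; rewrite sqr_ge0. Qed.

Let noise_energyE alpha beta w :
  noise_energy alpha beta w = (\int[mu]_t cut alpha beta (t, w))%E.
Proof.
rewrite /noise_energy integral_mkcond; apply: eq_integral => t _.
rewrite patchE /cut /=; case: ifPn => [|]; case: ifPn => //.
- by move=> tab; rewrite inE/= in_itv/= => tab'; rewrite tab' in tab.
- by move=> tab; rewrite notin_setE/= in_itv/= tab => /negP.
Qed.

Lemma measurable_noise_energy alpha beta : measurable_fun setT (noise_energy alpha beta).
Proof.
rewrite (_ : noise_energy _ _ = fubini_G mu (cut alpha beta)).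
  apply: (@measurable_fun_fubini_tonelli_G _ _ _ _ R mu (cut alpha beta)).
    exact: mcut.
  by move=> p; exact: cut_ge0.
by apply/funext => w; rewrite noise_energyE.
Qed.

Lemma noise_variance t : 0 <= t <= T ->
  (\int[P]_w (U (t, w) ^+ 2)%:E = (eps ^+ 2 * t `^ (2 * H * K))%:E)%E.
Proof.
move=> /andP[t0 tT].
have mUt : measurable_fun setT (fun w => U (t, w)).
  by apply: (measurableT_comp mU); exact: measurable_fun_pair.
have -> : (\int[P]_w (U (t, w) ^+ 2)%:E = \int[P]_w ((eps ^+ 2)%:E * (W t w * W t w)%:E))%E.
  apply: ge0_ae_eq_integral => //.
  - by apply/measurable_EFinP; exact: measurable_funX.
  - by apply: measurable_funeM; apply/measurable_EFinP; exact: measurable_funM.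
  - by move=> w _; rewrite lee_fin sqr_ge0.
  - by move=> w _; rewrite -EFinM lee_fin mulr_ge0 ?sqr_ge0// -expr2 sqr_ge0.
  - apply: filterS UW => w UWw _; rewrite UWw ?t0// -EFinM; congr EFin.
    by rewrite exprMn expr2.
rewrite integralZl//; last exact: (bifbm_integrable BW t0 t0).
by rewrite (bifbm_moment BW)// bifbm_var// -EFinM.
Qed.

Lemma expected_noise_energy alpha beta : 0 <= alpha -> alpha <= beta -> beta <= T ->
  (\int[P]_w noise_energy alpha beta w <=
    (eps ^+ 2 * T `^ (2 * H * K) * (beta - alpha))%:E)%E.
Proof.
move=> al0 ab bT.
have HK0 : 0 <= 2 * H * K by case/andP: HK1 => ? _; lra.
under eq_integral do rewrite noise_energyE.
rewrite -(@fubini_tonelli _ _ _ _ R mu P (cut alpha beta) (mcut _ _)); last first.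
  by move=> p; exact: cut_ge0.
apply: (@le_trans _ _ (\int[mu]_(t in `[alpha, beta]) (eps ^+ 2 * T `^ (2 * H * K))%:E)%E).
  rewrite [leRHS]integral_mkcond; apply: ge0_le_integral => //.
  - by move=> t _; apply: integral_ge0 => w _.
  - apply: (@measurable_fun_fubini_tonelli_F _ _ _ _ R P (cut alpha beta) (mcut _ _)).
    by move=> p; exact: cut_ge0.
  - exact: (proj1 (measurable_restrictT _ (measurable_itv _)) (measurable_cst _)).
  move=> t _; rewrite patchE; case: ifPn.
    rewrite inE/= in_itv/= => tab; case/andP: (tab) => at1 tb.
    have t0 : 0 <= t by exact: le_trans at1.
    have tT : t <= T by exact: le_trans bT.
    rewrite /cut/= tab noise_variance ?t0// lee_fin ler_wpM2l ?sqr_ge0//.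
    by rewrite ge0_ler_powR ?nnegrE// ltW.
  rewrite notin_setE/= in_itv/= => /negP/negbTE tab.
  by rewrite /cut/= tab integral0.
rewrite integral_cst//= lebesgue_measure_itv/= lte_fin.
case: ltP => [_|ba]; first by rewrite -EFinD -EFinM.
by rewrite mule0 lee_fin mulr_ge0 ?subr_ge0// mulr_ge0 ?sqr_ge0 ?powR_ge0.
Qed.

Lemma noise_energy_lty : {ae P, forall w, noise_energy 0 T w \is a fin_num}.
Proof.
have i : P.-integrable setT (noise_energy 0 T).
  apply/integrableP; split; first exact: measurable_noise_energy.
  under eq_integral do rewrite gee0_abs ?noise_energy_ge0//.
  by rewrite (le_lt_trans (expected_noise_energy (lexx 0) (ltW T0) (lexx T)))// ltry.
have := integrable_ae measurableT i.
by apply: filterS => w; apply.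
Qed.

End NoiseField.

(** * Mean square error of the estimator *)

Section MeanSquareError.
Context {R : realType} {d : measure_display} {Omega : measurableType d}.
Variables (P : probability Omega R) (H K T : R) (W : R -> {RV P >-> R}).
Local Notation mu := (@lebesgue_measure R).
Hypotheses (H1 : 0 < H < 1) (K1 : 0 < K <= 1) (HK1 : 2^-1 < H * K < 1) (T0 : 0 < T).
Hypothesis BW : bifractional_brownian_motion H K W.

(** The distance of the state to the limit solution, seen through a window, is
    of order [eps] in quadratic mean: the state error obeys an integral inequality
    driven by the noise, whose energy over an interval has an expectation of the
    order of its length. *)
Lemma state_error_moment (L x0 : R) : 0 < L -> exists2 C : R, 0 <= C &
  forall (eps : R) (theta : R -> R) (X : R -> Omega -> R) (g : R -> R)
    (alpha beta M : R),
  continuous theta -> (forall t, `|theta t| <= L) -> is_solution T W x0 eps theta X ->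
  measurable_fun [set: R] g -> (forall t, `|g t| <= M) ->
  (forall t, ~ (alpha <= t <= beta) -> g t = 0) ->
  0 <= alpha -> alpha < beta -> beta <= T ->
  exists V : Omega -> \bar R, [/\ measurable_fun setT V, forall w, (0 <= V w)%E,
    {ae P, forall w, (((\int[mu]_(t in `[0, T]) (g t * theta t * X t w) -
       \int[mu]_(t in `[0, T]) (g t * (theta t * limit_solution x0 theta t))) ^+ 2)%:E <= V w)%E} &
    (\int[P]_w V w <= (C * M ^+ 2 * eps ^+ 2 * (beta - alpha) ^+ 2)%:E)%E].
Proof.
move=> L0; have [C C0 hC] := window_integral_sqr_le T0 L0.
pose Tp := T `^ (2 * H * K); have Tp0 : 0 <= Tp by exact: powR_ge0.
exists (C * L ^+ 2 * (Tp * (T + 1))).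
  apply: mulr_ge0; first by apply: mulr_ge0 => //; exact: sqr_ge0.
  by rewrite mulr_ge0// addr_ge0// ltW.
move=> eps theta X g al be M tc tL sol mg gM g0 al0 ab bT.
have mth : measurable_fun [set: R] theta by exact: continuous_measurable_fun.
have [U mU UW] := noise_field mth sol.
pose E1 := noise_energy U 0 T; pose E2 := noise_energy U al be.
have mE1 : measurable_fun setT E1 by exact: measurable_noise_energy.
have mE2 : measurable_fun setT E2 by exact: measurable_noise_energy.
pose D := C * M ^+ 2 * L ^+ 2; pose w2 := (be - al) ^+ 2.
have w0 : 0 < be - al by rewrite subr_gt0.
have D0 : 0 <= D by rewrite mulr_ge0 ?sqr_ge0// mulr_ge0// sqr_ge0.
pose V w := (D%:E * (w2%:E * E1 w + (be - al)%:E * E2 w))%E.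
have w20 : 0 <= w2 by exact: sqr_ge0.
have p1 w : (0 <= w2%:E * E1 w)%E by rewrite mule_ge0// ?lee_fin// noise_energy_ge0.
have p2 w : (0 <= (be - al)%:E * E2 w)%E.
  by rewrite mule_ge0 ?lee_fin ?(ltW w0)// noise_energy_ge0.
have m1 : measurable_fun setT (fun w => w2%:E * E1 w)%E by exact: measurable_funeM.
have m2 : measurable_fun setT (fun w => (be - al)%:E * E2 w)%E by exact: measurable_funeM.
have m12 : measurable_fun setT (fun w => w2%:E * E1 w + (be - al)%:E * E2 w)%E.
  exact: emeasurable_funD.
exists V; split.
- exact: measurable_funeM.
- by move=> w; rewrite /V mule_ge0 ?lee_fin// adde_ge0.
- have fin := noise_energy_lty HK1 T0 BW mU UW.
  have [_ sol'] := sol.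
  apply: filterS3 sol' UW fin => w [iX eqX] Uw fw.
  pose x := limit_solution x0 theta.
  pose z t := theta t * (X t w - x t).
  pose u t := L * `|U (t, w)|.
  have itx : mu.-integrable `[0, T] (EFin \o (fun t => theta t * x t)).
    exact: integrable_segment (@limit_solution_drift_continuous R x0 theta tc T T0).
  have iz : mu.-integrable `[0, T] (EFin \o z).
    have -> : EFin \o z = (fun t => (theta t * X t w)%:E - (theta t * x t)%:E)%E.
      by apply/funext => t; rewrite /= /z mulrBr.
    exact: (integrableB _ iX itx).
  have mUw : measurable_fun [set: R] (fun t => U (t, w)).
    by apply: (measurableT_comp mU); exact: measurable_fun_pair.
  have mu_u : measurable_fun [set: R] u.
    by apply: measurable_funM => //; exact: measurableT_comp.
  have u2E t : u t ^+ 2 = L ^+ 2 * U (t, w) ^+ 2.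
    by rewrite /u exprMn real_normK// num_real.
  have iU2 : mu.-integrable `[0, T] (EFin \o (fun t => U (t, w) ^+ 2)).
    apply/integrableP; split.
      by apply: measurable_funTS; apply/measurable_EFinP; exact: measurable_funX.
    under eq_integral do rewrite /= ger0_norm ?sqr_ge0//.
    by move: fw; rewrite ge0_fin_numE ?noise_energy_ge0.
  have iu2 : mu.-integrable `[0, T] (EFin \o (fun t => u t ^+ 2)).
    have -> : (fun t => u t ^+ 2) = (fun t => L ^+ 2 * U (t, w) ^+ 2) by apply/funext.
    exact: (integrableZl _ (L ^+ 2) iU2).
  have zu t : 0 <= t <= T -> `|z t| <= L * \int[mu]_(s in `[0, t]) `|z s| + u t.
    move=> tT; case/andP: (tT) => t0 tT'.
    have izt := integrable_sub_segment (lexx 0) tT' iz.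
    have Dt : X t w - x t = \int[mu]_(s in `[0, t]) z s + U (t, w).
      rewrite eqX// /x limit_solution_equation// Uw//.
      have -> : \int[mu]_(s in `[0, t]) z s =
         \int[mu]_(s in `[0, t]) (theta s * X s w) -
         \int[mu]_(s in `[0, t]) (theta s * limit_solution x0 theta s).
        rewrite -RintegralB//.
        - by apply: eq_Rintegral => s _; rewrite /z /x mulrBr.
        - exact: (integrable_sub_segment (f := fun s => theta s * X s w) (lexx 0) tT' iX).
        - exact: integrable_sub_segment (lexx 0) tT' itx.
      ring.
    rewrite /z normrM Dt /u -mulrDr ler_pM//.
    rewrite (le_trans (ler_normD _ _))// lerD2r.
    exact: le_normr_Rintegral.
  have u0 t : 0 <= t <= T -> 0 <= u t by move=> _; rewrite mulr_ge0// ltW.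
  have B := hC z u g al be M al0 ab bT iz (measurable_funTS mu_u) u0 iu2 zu mg gM g0.
  have -> : \int[mu]_(t in `[0, T]) (g t * theta t * X t w) -
       \int[mu]_(t in `[0, T]) (g t * (theta t * limit_solution x0 theta t)) =
      \int[mu]_(t in `[0, T]) (g t * z t).
    have igb (h : R -> R) : mu.-integrable `[0, T] (EFin \o h) ->
        mu.-integrable `[0, T] (EFin \o (fun t => g t * h t)).
      move=> ih; apply: (@le_integrable _ _ _ mu _ _ _ (EFin \o (fun t => M * h t))) => //.
      - apply/measurable_EFinP; apply: measurable_funM; first exact: measurable_funTS.
        by case/integrableP: ih => /measurable_EFinP.
      - move=> t _ /=; rewrite lee_fin !normrM ler_wpM2r//.
        by rewrite (le_trans (gM t))// ler_norm.
      - exact: (integrableZl _ M ih).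
    rewrite -RintegralB//.
    - by apply: eq_Rintegral => t _; rewrite /z /x; ring.
    - have -> : (fun t => g t * theta t * X t w) = (fun t => g t * (theta t * X t w)).
        by apply/funext => t; rewrite mulrA.
      exact: (igb (fun t => theta t * X t w) iX).
    - exact: igb.
  have iU2w := integrable_sub_segment al0 bT iU2.
  have Ie x' y' : mu.-integrable `[x', y'] (EFin \o (fun t => U (t, w) ^+ 2)) ->
     (\int[mu]_(t in `[x', y']) u t ^+ 2 = L ^+ 2 * \int[mu]_(t in `[x', y']) U (t, w) ^+ 2) /\
     noise_energy U x' y' w = (\int[mu]_(t in `[x', y']) U (t, w) ^+ 2)%:E.
    move=> i; split.
      by rewrite -(RintegralZl _ _ i)//; apply: eq_Rintegral => t _; rewrite u2E.
    by rewrite /noise_energy fineK// integrable_fin_num.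
  have [e1 e1'] := Ie _ _ iU2; have [e2 e2'] := Ie _ _ iU2w.
  rewrite /V /E1 /E2 e1' e2' -!EFinM lee_fin (le_trans B)// e1 e2.
  by rewrite le_eqVlt; apply/orP; left; apply/eqP; rewrite /D /w2; ring.
- rewrite /V ge0_integralZl//; last by move=> w _; rewrite adde_ge0.
  rewrite ge0_integralD// ge0_integralZl//; last by move=> w _; exact: noise_energy_ge0.
  rewrite ge0_integralZl//; last 2 first.
  - by move=> w _; exact: noise_energy_ge0.
  - by rewrite lee_fin ltW.
  have h1 := expected_noise_energy HK1 T0 BW mU UW (lexx 0) (ltW T0) (lexx T).
  have h2 := expected_noise_energy HK1 T0 BW mU UW al0 (ltW ab) bT.
  apply: (@le_trans _ _ (D%:E * (w2%:E * (eps ^+ 2 * Tp * (T - 0))%:E +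
      (be - al)%:E * (eps ^+ 2 * Tp * (be - al))%:E))%E).
    apply: lee_wpmul2l; first by rewrite lee_fin.
    apply: leeD.
      by apply: lee_wpmul2l; [rewrite lee_fin|exact: h1].
    by apply: lee_wpmul2l; [rewrite lee_fin ltW|exact: h2].
  rewrite -!EFinM lee_fin le_eqVlt; apply/orP; left; apply/eqP.
  by rewrite /D /w2; move: Tp {Tp0 h1 h2} => q; ring.
Qed.

End MeanSquareError.

Lemma sqrD3_le {R : realDomainType} (x y z : R) :
  (x + y + z) ^+ 2 <= 3 * (x ^+ 2 + (y ^+ 2 + z ^+ 2)).
Proof.
have q1 : 0 <= (x - y) ^+ 2 by exact: sqr_ge0.
have q2 : 0 <= (y - z) ^+ 2 by exact: sqr_ge0.
have q3 : 0 <= (x - z) ^+ 2 by exact: sqr_ge0.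
have -> : 3 * (x ^+ 2 + (y ^+ 2 + z ^+ 2)) = (x + y + z) ^+ 2 +
  ((x - y) ^+ 2 + (y - z) ^+ 2 + (x - z) ^+ 2) by ring.
by rewrite lerDl !addr_ge0.
Qed.

Section Estimator.
Context {R : realType} {d : measure_display} {Omega : measurableType d}.
Variables (P : probability Omega R) (H K T x0 L L1 : R) (k : nat).
Variables (G : R -> R) (M A B a b : R) (W : R -> {RV P >-> R}).
Local Notation mu := (@lebesgue_measure R).
Hypotheses (H1 : 0 < H < 1) (K1 : 0 < K <= 1) (HK1 : 2^-1 < H * K < 1) (T0 : 0 < T).
Hypotheses (L0 : 0 < L) (L10 : 0 < L1).
Hypotheses (mG : measurable_fun [set: R] G) (GM : forall u, `|G u| <= M).
Hypotheses (A0 : A < 0) (B0 : 0 < B) (G0 : forall u, ~ (A <= u <= B) -> G u = 0).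
Hypothesis G1 : \int[mu]_(u in `[A, B]) G u = 1.
Hypothesis Gj : forall j : nat, (1 <= j <= k)%N -> \int[mu]_u (u ^+ j * G u) = 0.
Hypothesis BW : bifractional_brownian_motion H K W.
Hypotheses (a0 : 0 < a) (bT : b < T).

(** The error splits into the kernel average of the state error, the bias of the
    kernel average of the limit, and the Wiener integral of the kernel. *)
Lemma estimator_mse_bound : exists C r : R, [/\ 0 <= C, 0 < r &
  forall (eps phi : R) theta (X : R -> Omega -> R) (Y : R -> {RV P >-> R}) t,
  0 < phi -> phi * (B - A) < r -> Theta k.+1 L L1 theta ->
  is_solution T W x0 eps theta X ->
  is_estimator H K T W G phi eps theta X Y -> a <= t <= b ->
  ('E_P[(fun w => `|Y t w - theta t * limit_solution x0 theta t| ^+ 2)%R] <=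
   (C * (eps ^+ 2 + phi ^+ (2 * k.+1) + eps ^+ 2 * phi `^ (2 * H * K - 2)))%:E)%E].
Proof.
have BA0 : 0 < B - A by rewrite subr_gt0 (lt_trans A0).
(* [a / 2] and [T - b] keep the window inside [a / 2, T], and [1] is the radius of
   the Taylor expansions *)
pose r := Num.min 1 (Num.min (a / 2) (T - b)).
have a20 : 0 < a / 2 by rewrite divr_gt0.
have r0 : 0 < r by rewrite /r !lt_min ltr01 a20 subr_gt0.
have r1 : r <= 1 by rewrite /r ge_min lexx.
have ra2 : r <= a / 2 by rewrite /r !ge_min lexx/= orbT.
have ra : r <= a by rewrite (le_trans ra2)// ler_pdivrMr// ler_peMr ?ler1n// ltW.
have rT : r <= T - b by rewrite /r !ge_min lexx !orbT.
have [_ [Ct Ct0 hCt]] :=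
  @taylor_family_limit_solution R k.+1 L L1 x0 r a b L0 L10 r0 r1 ra isT k.+1 (leqnSn _).
have [Cw Cw0 hCw] := wiener_integral_moment_le BW H1 K1 HK1 T0 a20.
have [Cs Cs0 hCs] := state_error_moment HK1 T0 BW x0 L0.
have M0 : 0 <= M by exact: le_trans (GM 0).
pose c1 := Cs * M ^+ 2 * (B - A) ^+ 2.
pose c2 := (M * Ct * (B - A) ^+ k.+2) ^+ 2.
pose c3 := Cw * (B - A) `^ (2 * H * K) * M ^+ 2.
have c10 : 0 <= c1 by apply: mulr_ge0; rewrite ?sqr_ge0// mulr_ge0// sqr_ge0.
have c20 : 0 <= c2 by exact: sqr_ge0.
have c30 : 0 <= c3 by apply: mulr_ge0; rewrite ?sqr_ge0// mulr_ge0// powR_ge0.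
exists (3 * (c1 + c2 + c3)), r; split => //.
  by rewrite mulr_ge0// !addr_ge0.
move=> eps phi theta X Y t phi0 phir Tth sol est /andP[at1 tb].
have [tL td _] := Tth.
have tc : continuous theta by apply: derivable1_continuous => x; exact: (td 0%N x isT).
have t0 : 0 < t by exact: lt_le_trans at1.
have tT : t < T by exact: le_lt_trans bT.
pose al := t + phi * A; pose be := t + phi * B.
have bal : be - al = phi * (B - A) by rewrite /be /al; ring.
have bal0 : 0 < be - al by rewrite bal mulr_gt0.
have albe : al < be by rewrite -subr_gt0.
have pA : - (phi * (B - A)) <= phi * A.
  by rewrite -mulrN ler_pM2l// opprB lerBlDl lerDr ltW.
have pB : phi * B <= phi * (B - A).
  by rewrite ler_pM2l// lerDl oppr_ge0 ltW.
have aal : a / 2 <= al.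
  have h1 : - (a / 2) <= phi * A.
    by apply: le_trans pA; rewrite lerN2 (le_trans (ltW phir)).
  have : a + - (a / 2) <= t + phi * A by exact: lerD.
  by rewrite (_ : a + - (a / 2) = a / 2)//; field.
have beT : be <= T.
  have h1 : phi * B <= T - b by rewrite (le_trans pB)// (le_trans (ltW phir)).
  by have := lerD tb h1; rewrite subrKC.
have al0 : 0 <= al by rewrite (le_trans _ aal)// ltW.
pose g tau := G ((tau - t) / phi).
have mg : measurable_fun [set: R] g.
  apply: measurableT_comp => //; apply: measurable_funM => //.
  exact: measurable_funB.
have gM u : `|g u| <= M by exact: GM.
have g0 u : ~ (al <= u <= be) -> g u = 0.
  move=> h; apply: G0 => /andP[h1 h2]; apply: h; apply/andP; split.
    by move: h1; rewrite ler_pdivlMr// lerBrDl mulrC.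
  by move: h2; rewrite ler_pdivrMr// lerBlDl mulrC.
have [V [mV V0 hV EV]] := hCs eps theta X g al be M tc tL sol mg gM g0 al0 albe beT.
have [|Z [J WJ ZE] YZ] := est t; first by rewrite (ltW t0) ltW.
have EJ := hCw al be M g J aal albe beT mg gM g0 WJ.
pose F s := theta s * limit_solution x0 theta s.
have bias : `|phi^-1 * \int[mu]_(u in `[0, T]) (g u * F u) - F t| <=
     M * Ct * (B - A) ^+ k.+2 * phi ^+ k.+1.
  have [p [pk _ Fp]] := hCt (theta, t) (conj Tth (introT andP (conj at1 tb))).
  apply: (@kernel_bias R G M A B k mG GM A0 B0 G0 G1 Gj F p Ct
    (L * (`|x0| * expR (L * T))) T t phi r) => //.
  - have := integrable_segment (@limit_solution_drift_continuous R x0 theta tc T T0).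
    by case/integrableP => /measurable_EFinP.
  - move=> u /andP[u0 uT]; rewrite /F normrM ler_pM//.
    rewrite (le_trans (limit_solution_bound x0 tc tL u0))//.
    by rewrite ler_wpM2l// ler_expR ler_wpM2l// ltW.
pose bs := phi^-1 * \int[mu]_(u in `[0, T]) (g u * F u) - F t.
pose e1 := phi^-1 ^+ 2; pose e2 := (phi^-1 * eps) ^+ 2.
have e10 : 0 <= e1 by exact: sqr_ge0.
have e20 : 0 <= e2 by exact: sqr_ge0.
have mJ : measurable_fun setT (fun w => (J w ^+ 2)%:E).
  by apply/measurable_EFinP; apply: measurable_funX; exact: measurable_funPT.
have J0 w : (0 <= (J w ^+ 2)%:E)%E by rewrite lee_fin sqr_ge0.
pose Q w := (e1%:E * V w + ((bs ^+ 2)%:E + e2%:E * (J w ^+ 2)%:E))%E.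
have mQ1 : measurable_fun setT (fun w => e1%:E * V w)%E by exact: measurable_funeM.
have mQ3 : measurable_fun setT (fun w => e2%:E * (J w ^+ 2)%:E)%E by exact: measurable_funeM.
have mQ23 : measurable_fun setT (fun w => (bs ^+ 2)%:E + e2%:E * (J w ^+ 2)%:E)%E.
  by apply: emeasurable_funD => //; exact: measurable_cst.
have mQ : measurable_fun setT Q by exact: emeasurable_funD.
have Q1 w : (0 <= e1%:E * V w)%E by rewrite mule_ge0.
have Q3 w : (0 <= e2%:E * (J w ^+ 2)%:E)%E by rewrite mule_ge0.
have bs0 : (0 <= (bs ^+ 2)%:E)%E by rewrite lee_fin sqr_ge0.
have Q23 w : (0 <= (bs ^+ 2)%:E + e2%:E * (J w ^+ 2)%:E)%E by rewrite adde_ge0.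
have Q0 w : (0 <= Q w)%E by rewrite adde_ge0.
rewrite expectation.unlock.
apply: (@le_trans _ _ (\int[P]_w (3%:E * Q w))%E).
  apply: ae_ge0_le_integral.
  - exact: measurableT.
  - by move=> w _; rewrite lee_fin exprn_ge0.
  - apply/measurable_EFinP; apply: measurable_funX; apply: measurableT_comp => //.
    by apply: measurable_funB => //; exact: measurable_funPT.
  - by move=> w _; rewrite mule_ge0.
  - exact: measurable_funeM.
  apply: filterS3 hV ZE YZ => w Vw Zw Yw _.
  set I1 := \int[mu]_(s in `[0, T]) (g s * theta s * X s w) in Vw Zw.
  set I2 := \int[mu]_(s in `[0, T]) (g s * _) in Vw.
  have E : Y t w - theta t * limit_solution x0 theta t =
      phi^-1 * (I1 - I2) + bs + phi^-1 * eps * J w.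
    rewrite Yw Zw -/(F t) /bs.
    have -> : \int[mu]_(u in `[0, T]) (g u * F u) = I2 by [].
    by clear Vw Zw Yw; rewrite -/g; move: I1 I2 (F t) (J w) => i1 i2 f j; ring.
  apply: (@le_trans _ _ (3%:E * ((phi^-1 * (I1 - I2)) ^+ 2 + (bs ^+ 2 + (phi^-1 * eps * J w) ^+ 2))%:E)%E).
    rewrite E -EFinM lee_fin real_normK ?num_real//.
    exact: sqrD3_le.
  apply: lee_wpmul2l; first by rewrite lee_fin.
  rewrite !EFinD /Q; apply: leeD.
    by rewrite exprMn EFinM; apply: lee_wpmul2l.
  by apply: leeD => //; rewrite exprMn EFinM.
rewrite ge0_integralZl//.
rewrite ge0_integralD// ge0_integralD//.
rewrite !ge0_integralZl// integral_cst//.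
rewrite [X in (_ + (_ * X + _))%E](_ : _ = 1%E); last exact: probability_setT.
rewrite mule1.
rewrite expectation.unlock in EJ.
apply: (@le_trans _ _ (3%:E * (e1%:E * (Cs * M ^+ 2 * eps ^+ 2 * (be - al) ^+ 2)%:E +
  (((M * Ct * (B - A) ^+ k.+2 * phi ^+ k.+1) ^+ 2)%:E +
   e2%:E * (Cw * (be - al) `^ (2 * H * K) * M ^+ 2)%:E)))%E).
  apply: lee_wpmul2l; first by rewrite lee_fin.
  apply: leeD; first by apply: lee_wpmul2l.
  apply: leeD; last by apply: lee_wpmul2l.
  rewrite lee_fin -(real_normK (num_real bs)) lerXn2r ?nnegrE//.
  by rewrite (le_trans _ bias).
rewrite -!EFinM lee_fin.
have pE : (be - al) `^ (2 * H * K) = phi ^+ 2 * phi `^ (2 * H * K - 2) * (B - A) `^ (2 * H * K).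
  rewrite bal powRM ?(ltW phi0) ?(ltW BA0)//; congr (_ * _).
  rewrite -(powR_mulrn 2 (ltW phi0)) -powRD ?(gt_eqF phi0) ?implybT//.
  by congr (_ `^ _); ring.
rewrite pE bal /e1 /e2.
have phin0 : phi != 0 by rewrite gt_eqF.
have -> : 3 * (phi^-1 ^+ 2 * (Cs * M ^+ 2 * eps ^+ 2 * (phi * (B - A)) ^+ 2) +
   ((M * Ct * (B - A) ^+ k.+2 * phi ^+ k.+1) ^+ 2 +
    (phi^-1 * eps) ^+ 2 *
    (Cw * (phi ^+ 2 * phi `^ (2 * H * K - 2) * (B - A) `^ (2 * H * K)) * M ^+ 2))) =
  3 * (c1 * eps ^+ 2 + c2 * phi ^+ (2 * k.+1) + c3 * (eps ^+ 2 * phi `^ (2 * H * K - 2))).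
  rewrite /c1 /c2 /c3 mulnC exprM.
  move: (phi `^ _) ((B - A) `^ _) ((B - A) ^+ k.+2) (phi ^+ k.+1) => x y z q.
  by field.
rewrite -[leRHS]mulrA ler_wpM2l//.
have E1 : 0 <= eps ^+ 2 by exact: sqr_ge0.
have E2 : 0 <= phi ^+ (2 * k.+1) by rewrite exprn_ge0// ltW.
have E3 : 0 <= eps ^+ 2 * phi `^ (2 * H * K - 2) by rewrite mulr_ge0// powR_ge0.
move: (eps ^+ 2) (phi ^+ _) (eps ^+ 2 * _) E1 E2 E3 => x y z x0' y0 z0.
have -> : (c1 + c2 + c3) * (x + y + z) = (c1 * x + c2 * y + c3 * z) +
   (c1 * (y + z) + c2 * (x + z) + c3 * (x + y)) by ring.
by rewrite lerDl !addr_ge0// mulr_ge0// addr_ge0.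
Qed.

End Estimator.

(** * The rate *)

Section Rate.
Context {R : realType}.

(** The bandwidth balances the squared bias and the variance, and the common
    order is at least the order [eps ^+ 2] of the state error. *)
Lemma bandwidth_rate (H K : R) (k : nat) (eps : R) : H * K < 1 -> 0 < eps -> eps <= 1 ->
  (eps ^+ 2 + bandwidth H K k eps ^+ (2 * k.+1) +
     eps ^+ 2 * bandwidth H K k eps `^ (2 * H * K - 2)) *
    eps `^ (- Num.min 2 (2 * k.+1%:R / (k.+2%:R - H * K))) <= 3.
Proof.
move=> HK eps0 eps1; set phi := bandwidth H K k eps.
pose D : R := k.+2%:R - H * K; pose rho := 2 * k.+1%:R / D.
have kD : k.+1%:R < D by rewrite /D -(natr1 k.+1); move: (H * K) HK (k.+1%:R : R) => x x1 y; lra.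
have D0 : 0 < D by exact: le_lt_trans kD.
have rho2 : rho <= 2.
  by rewrite /rho ler_pdivrMr// ler_wpM2l// ltW.
have -> : Num.min 2 (2 * k.+1%:R / (k.+2%:R - H * K)) = rho.
  by rewrite -/D -/rho min_r.
have DE : k%:R - H * K + 2 = D by rewrite /D -(natr1 k.+1) -(natr1 k); ring.
have phiE : phi = eps `^ (1 / D) by rewrite /phi /bandwidth DE.
have epsn : eps != 0 by rewrite gt_eqF.
have Dn : D != 0 by rewrite gt_eqF.
have t1 : eps ^+ 2 <= eps `^ rho.
  by rewrite -(powR_mulrn 2 (ltW eps0)) ger_powR// eps0.
have t2 : phi ^+ (2 * k.+1) = eps `^ rho.
  rewrite -powR_mulrn ?phiE ?powR_ge0// -powRrM natrM; congr (_ `^ _).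
  by rewrite /rho; field.
have t3 : eps ^+ 2 * phi `^ (2 * H * K - 2) = eps `^ rho.
  rewrite -(powR_mulrn 2 (ltW eps0)) phiE -powRrM -powRD ?epsn ?implybT//.
  have HKE : 2 * H * K = 2 * (k.+1%:R + 1 - D) by rewrite /D -(natr1 k.+1); ring.
  by congr (_ `^ _); rewrite HKE /rho; field.
rewrite t2 t3 powRN ler_pdivrMr ?powR_gt0//.
by move: (eps `^ rho) (eps ^+ 2) t1 => x y; lra.
Qed.

Lemma bandwidth_near0 (H K : R) (k : nat) (c e : R) : H * K < 1 -> 0 < c -> 0 < e ->
  \forall eps \near (0:R)^'+, bandwidth H K k eps * c < e.
Proof.
move=> HK c0 e0.
have q0 : 0 < 1 / (k%:R - H * K + 2).
  rewrite divr_gt0//; have : 0 <= k%:R :> R by rewrite ler0n.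
  by move: (H * K) (k%:R : R) HK => x y; lra.
have /cvgrPdist_lt/(_ (e / c) (divr_gt0 e0 c0)) := powR_cvg0 q0.
apply: filterS => eps; rewrite sub0r normrN ger0_norm ?powR_ge0//.
by rewrite ltr_pdivlMr.
Qed.

End Rate.

Theorem theorem4p2 (R : realType) (d : measure_display)
    (Omega : measurableType d) (P : probability Omega R)
    (H K T x0 L L1 : R) (k : nat) (G : R -> R) (A B : R)
    (W : R -> {RV P >-> R})
    (X : R -> (R -> R) -> R -> Omega -> R)
    (Y : R -> (R -> R) -> R -> {RV P >-> R})
    (a b : R) :
  0 < H < 1 -> 0 < K <= 1 -> 2^-1 < H * K < 1 ->
  0 < T -> 0 < L -> 0 < L1 ->
  measurable_fun [set: R] G ->
  (exists M : R, forall u, `|G u| <= M) ->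
  A < 0 -> 0 < B ->
  (forall u, ~ (A <= u <= B) -> G u = 0) ->
  \int[lebesgue_measure]_(u in `[A, B]) G u = 1 ->
  (forall j : nat, (1 <= j <= k)%N ->
    \int[lebesgue_measure]_u (u ^+ j * G u) = 0) ->
  bifractional_brownian_motion H K W ->
  (forall eps theta, 0 < eps -> Theta k.+1 L L1 theta ->
    is_solution T W x0 eps theta (X eps theta)) ->
  (forall eps theta, 0 < eps -> Theta k.+1 L L1 theta ->
    is_estimator H K T W G (bandwidth H K k eps) eps theta (X eps theta)
      (Y eps theta)) ->
  0 < a -> a <= b -> b < T ->
  (limf_esup (fun eps : R =>
     ereal_sup [set ereal_sup
         [set 'E_P[(fun w : Omega =>
                 `|Y eps theta t w - theta t * limit_solution x0 theta t| ^+ 2)%R]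
              * (eps `^ (- Num.min 2 (2 * k.+1%:R / (k.+2%:R - H * K)))%R)%:E
         | t in `[a, b]%classic]
       | theta in Theta k.+1 L L1])
   (0^'+)%R < +oo)%E.
Proof.
move=> H1 K1 HK1 T0 L0 L10 mG [M GM] A0 B0 G0 G1 Gj BW sol est a0 ab bT.
have [C [r [C0 r0 hC]]] :=
  estimator_mse_bound x0 H1 K1 HK1 T0 L0 L10 mG GM A0 B0 G0 G1 Gj BW a0 bT.
have HK : H * K < 1 by case/andP: HK1.
have BA0 : 0 < B - A by rewrite subr_gt0 (lt_trans A0).
pose S : set R := [set eps | [/\ 0 < eps, eps <= 1 & bandwidth H K k eps * (B - A) < r]].
have S0 : (0^'+)%R S.
  near=> eps; split.
  - by near: eps; exact: nbhs_right_gt.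
  - by near: eps; exact: nbhs_right_le.
  - by near: eps; exact: bandwidth_near0.
rewrite limf_esupE; apply: (@le_lt_trans _ _ (C * 3)%:E); last exact: ltry.
apply: le_trans (ereal_inf_lbound _) _; first by exists S.
apply: ge_ereal_sup => _ [eps [eps0 eps1 small] <-].
apply: ge_ereal_sup => _ [theta Tth <-].
apply: ge_ereal_sup => _ [t tab <-].
have phi0 : 0 < bandwidth H K k eps by exact: powR_gt0.
move: tab; rewrite /= in_itv/= => tab.
have := hC eps _ theta (X eps theta) (Y eps theta) t phi0 small Tth
  (sol _ _ eps0 Tth) (est _ _ eps0 Tth) tab.
move/(@lee_wpmul2r _ (eps `^ (- Num.min 2 (2 * k.+1%:R / (k.+2%:R - H * K))))%:E).
rewrite lee_fin powR_ge0 => /(_ isT)/le_trans; apply.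
rewrite -EFinM lee_fin -[leLHS]mulrA ler_wpM2l//.
exact: bandwidth_rate.
Unshelve. all: by end_near. Qed.
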